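(* Let $a=\rho e^{i\zeta}$ with $0\le\rho<1$ and $\zeta\in\mathbb{R}$, and define the infinite matrix $H_a$ by $$(H_a)_{n,m} \equiv \langle f_m, \mathcal{M}_a f_n\rangle,\qquad n,m\in\mathbb{Z}\setminus\{0\}.$$ Then $H_a$ has the following properties: (i) $H_a$ is the matrix representation of $J_a^{1/2}\mathcal{M}_a$ (as an operator on $L^2_\diamond(\partial\mathbb{D})$) in the basis $\{f_n\}_{n\in\mathbb{Z}\setminus\{0\}}$. (ii) The conjugate transpose $(H_a)^*$ is the matrix representation of $P\mathcal{M}_a$ (as an operator on $L^2_\diamond(\partial\mathbb{D})$) in the basis $\{f_n\}_{n\in\mathbb{Z}\setminus\{0\}}$. (iii) $H_a$ is involutory, i.e. $H_a = H_a^{-1}$. (iv) $(H_a)_{n,m} = e^{i(m-n)\zeta}(H_\rho)_{n,m}$ for all $n,m\in\mathbb{Z}\setminus\{0\}$. (v) $H_a$ is centrohermitian, i.e. $(H_a)_{n,m} = \overline{(H_a)_{-n,-m}}$ for all $n,m\in\mathbb{Z}\setminus\{0\}$. (vi) $H_a$ is block diagonal: $(H_a)_{n,m}=0$ for $n<0,\ m>0$ and for $n>0,\ m<0$. (vii) For $n>0$ and $m>0$, $$(H_\rho)_{n,m} = \sum_{k=\max\{n-m,0\}}^{n} (-1)^{n-k}\binom{k+m-1}{k+m-n}\binom{n}{k}\rho^{2k+m-n}.$$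
   Context: $\mathbb{D}$ is the open unit disk in $\mathbb{R}^2\cong\mathbb{C}$, with boundary $\partial\mathbb{D}$ parametrized by $e^{i\theta}$. $\langle f,g\rangle=\int_{\partial\mathbb{D}} f\overline{g}\,ds$ is the $L^2(\partial\mathbb{D})$ inner product, and $L^2_\diamond(\partial\mathbb{D})=\{w\in L^2(\partial\mathbb{D}):\int_{\partial\mathbb{D}}w\,ds=0\}$. The Fourier basis of $L^2_\diamond(\partial\mathbb{D})$ is $f_n(\theta)=\frac{1}{\sqrt{2\pi}}e^{in\theta}$, $n\in\mathbb{Z}\setminus\{0\}$. The matrix representation of a bounded linear operator $\mathcal{F}$ on $L^2_\diamond(\partial\mathbb{D})$ is the infinite matrix with entries $\langle\mathcal{F}f_m,f_n\rangle$ (row $n$, column $m$), $n,m\in\mathbb{Z}\setminus\{0\}$. For $a\in\mathbb{D}$, $M_a(x)=\frac{x-a}{\overline{a}x-1}$ is a Möbius transformation mapping $\mathbb{D}$ to $\mathbb{D}$ and $\partial\mathbb{D}$ to $\partial\mathbb{D}$, and $\mathcal{M}_a f = f\circ M_a$; in particular $(\mathcal{M}_a f_n)(\theta)=\frac{1}{\sqrt{2\pi}}M_a(e^{i\theta})^n$. $J_a^{1/2}$ denotes the operator of multiplication on $L^2(\partial\mathbb{D})$ by the function $x\mapsto\frac{1-|a|^2}{|\overline{a}x-1|^2}$, $x\in\partial\mathbb{D}$. $P:L^2(\partial\mathbb{D})\to L^2_\diamond(\partial\mathbb{D})$ is the orthogonal projection $Pf=f-\frac{1}{2\pi}\int_{\partial\mathbb{D}}f\,ds$.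 $H_\rho$ denotes $H_a$ with $a$ replaced by the real number $\rho\in[0,1)$. The convention $0^0=1$ is used. *)

(* Defs.v *)
From HB Require Import structures.
From mathcomp Require Import all_boot all_order all_algebra.
From mathcomp Require Import all_classical all_reals all_analysis.
From mathcomp Require Import complex.

Set Implicit Arguments.
Unset Strict Implicit.
Unset Printing Implicit Defensive.

Import Order.TTheory GRing.Theory Num.Theory.
Import numFieldNormedType.Exports.

Local Open Scope classical_set_scope.
Local Open Scope ring_scope.
Local Open Scope complex_scope.

Section CircleL2.
Variable R : realType.

(* A function on the unit circle is represented by a total function
   f : R[i] -> R[i]; every notion below only looks at the values f (expi t),
   i.e., at the restriction of f to the circle. *)

Definition expi (t : R) : R[i] := cos t +i* sin t.

Definition period : set R := `[0, 2 * pi]%classic.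

Local Notation mu := (@lebesgue_measure R).

(* Arc length on the unit circle is dt along t |-> expi t. *)
Definition circle_int (f : R[i] -> R[i]) : R[i] :=
  Rintegral mu period (fun t => complex.Re (f (expi t)))
  +i* Rintegral mu period (fun t => complex.Im (f (expi t))).

Definition circle_ae_eq (f g : R[i] -> R[i]) : Prop :=
  {ae mu, forall t, period t -> f (expi t) = g (expi t)}.

Definition L2 (f : R[i] -> R[i]) : Prop :=
  [/\ measurable_fun period (fun t => complex.Re (f (expi t))),
      measurable_fun period (fun t => complex.Im (f (expi t))) &
      (\int[mu]_(t in period) ((Normc.normc (f (expi t)) ^+ 2)%:E) < +oo)%E].

Definition L2diamond (f : R[i] -> R[i]) : Prop := L2 f /\ circle_int f = 0.

Definition inner (f g : R[i] -> R[i]) : R[i] :=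
  circle_int (fun x => f x * (g x)^*).

(* [inner f f] is a nonnegative real. *)
Definition L2norm (f : R[i] -> R[i]) : R := Num.sqrt (complex.Re (inner f f)).

(* [x ^ n] is the integer power; on the circle,
   fourier n (expi t) = (2 pi)^(-1/2) e^{i n t}. *)
Definition fourier (n : int) : R[i] -> R[i] :=
  fun x => ((Num.sqrt (2 * pi))^-1)%:C * x ^ n.

(* Bounded linear operators on the Hilbert space of classes, modulo equality
   almost everywhere, of functions in L2diamond. *)
Definition bounded_operator (F : (R[i] -> R[i]) -> (R[i] -> R[i])) : Prop :=
  [/\ forall f, L2diamond f -> L2diamond (F f),
      forall f g, L2diamond f -> L2diamond g ->
        circle_ae_eq f g -> circle_ae_eq (F f) (F g),
      forall (c : R[i]) f g, L2diamond f -> L2diamond g ->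
        circle_ae_eq (F (fun x => c * f x + g x))
                     (fun x => c * F f x + F g x) &
      exists K : R, forall f, L2diamond f -> L2norm (F f) <= K * L2norm f].

(* An infinite matrix indexed by the nonzero integers is a function
   int -> int -> R[i] of which only the entries with both indices nonzero are
   ever considered. *)
Definition matrix_rep (F : (R[i] -> R[i]) -> (R[i] -> R[i]))
    (A : int -> int -> R[i]) : Prop :=
  bounded_operator F /\
  forall n m : int, n != 0 -> m != 0 -> A n m = inner (F (fourier m)) (fourier n).

Definition conj_transpose (A : int -> int -> R[i]) : int -> int -> R[i] :=
  fun n m => (A m n)^*.

(* The series of the u k over the nonzero integers converges absolutely, with
   sum l. *)
Definition nzsum (u : int -> R[i]) (l : R[i]) : Prop :=
  summable [set k : int | k != 0] (fun k => (Normc.normc (u k))%:E) /\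
  (fun N : nat => Normc.normc
     (\sum_(1 <= k < N.+1) (u k%:Z + u (- k%:Z)) - l)) @ \oo --> (0 : R).

Definition matrix_prod (A B C : int -> int -> R[i]) : Prop :=
  forall n m : int, n != 0 -> m != 0 -> nzsum (fun k => A n k * B k m) (C n m).

Definition matrix_id : int -> int -> R[i] := fun n m => (n == m)%:R.

Definition matrix_inverse (A B : int -> int -> R[i]) : Prop :=
  matrix_prod A B matrix_id /\ matrix_prod B A matrix_id.

Definition involutory (A : int -> int -> R[i]) : Prop := matrix_inverse A A.

Definition moebius (a : R[i]) : R[i] -> R[i] :=
  fun x => (x - a) / (a^* * x - 1).

Definition Mop (a : R[i]) (f : R[i] -> R[i]) : R[i] -> R[i] := f \o moebius a.

(* The norm `|_| of R[i] takes values in R[i]. *)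
Definition Jhalf (a : R[i]) (f : R[i] -> R[i]) : R[i] -> R[i] :=
  fun x => (1 - `|a| ^+ 2) / `|a^* * x - 1| ^+ 2 * f x.

Definition Pproj (f : R[i] -> R[i]) : R[i] -> R[i] :=
  fun x => f x - ((2 * pi)^-1)%:C * circle_int f.

Definition Hmx (a : R[i]) : int -> int -> R[i] :=
  fun n m => inner (fourier m) (Mop a (fourier n)).

End CircleL2.

(* Main.v *)
(** On the circle M_a acts as e^{it} |-> e^{i lift(t)}, where lift is a smooth
    increasing bijection of R whose derivative is the density of J_a^{1/2};
    reducing lift modulo 2 pi gives a self-map of [0, 2 pi] along which Lebesgue
    measure is transported with that density.  This change of variables gives
    the boundedness of the two operators and identifies the matrix entries, all of
    which are (conjugates of) the Fourier coefficients of M_a^n.  For n > 0,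
    M_a(x)^n = (a - x)^n (1 - a^* x)^{-n} is a power series that converges
    absolutely on the circle: the binomial theorem gives its coefficients, hence
    the closed formula, the block structure and the dependence on the argument
    of a.  Substituting M_a into this series and integrating term by term against
    e^{-imt} shows that H_a is an involution, since M_a (M_a x) = x. *)

Require Import Defs.
From HB Require Import structures.
From mathcomp Require Import all_boot all_order all_algebra.
From mathcomp Require Import all_classical all_reals all_analysis.
From mathcomp Require Import measurable_realfun complex zify ring lra.

Set Implicit Arguments.
Unset Strict Implicit.
Unset Printing Implicit Defensive.

Import Order.TTheory GRing.Theory Num.Theory.
Import numFieldNormedType.Exports.

Local Open Scope classical_set_scope.
Local Open Scope complex_scope.
(* With ring_scope on top, ^* is Num.conj, as in the products of the
   definitions; elsewhere they use the convertible conjc of complex_scope. *)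
Local Open Scope ring_scope.

(** * Change of variables *)

(** The operators act on classes modulo null sets, so composition with [M_a] has to preserve square
    integrability and almost-everywhere equality. Both rest on two-sided bounds of the density: it
    lies between [(1 - rho) / (1 + rho)] and [(1 + rho) / (1 - rho)], so inserting or removing it
    costs only a constant. The power series is available for rows of positive index. On the circle
    [M_a^{-n}] is the conjugate of [M_a^n], so conjugating and negating both indices carries the
    results to the negative rows. Series are handled through explicit error sequences: the distance
    to the [N]-th partial sum is at most [e N], uniformly on the circle, with [e] tending to 0. Such
    a bound survives sums, multiplication by monomials and, up to a factor 2, integration. For
    [(1 - z)^{-n}] the error is controlled by induction on [n], since multiplying by [1 - z]
    telescopes the partial sums. *)

Section Substitution.
Local Open Scope ereal_scope.
Import HBNNSimple.

(** The usual passage from sets to functions: for an indicator this is the hypothesis on [nu],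
    linearity gives simple functions, and monotone convergence along [nnsfun_approx] gives [g]. *)
Lemma ge0_integral_substitution d1 d2 (X : measurableType d1)
    (Y : measurableType d2) (R : realType)
    (mu : {measure set X -> \bar R}) (nu : {measure set Y -> \bar R})
    (F : X -> Y) (w : X -> R) :
  measurable_fun setT F -> measurable_fun setT w -> (forall x, 0 <= w x)%R ->
  (forall A, measurable A -> nu A = \int[mu]_(x in F @^-1` A) (w x)%:E) ->
  forall g : Y -> \bar R, measurable_fun setT g -> (forall y, 0 <= g y) ->
  \int[nu]_y g y = \int[mu]_x (g (F x) * (w x)%:E).
Proof.
move=> mF mw w0 nuE g mg g0.
have mFA A : measurable A -> measurable (F @^-1` A).
  by move=> mA; rewrite -[X in measurable X]setTI; exact: mF.
pose h := nnsfun_approx measurableT mg.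
transitivity (lim (\int[nu]_y (EFin \o h n) y @[n --> \oo])).
  rewrite -monotone_convergence//.
  - apply: eq_integral => y _; apply/esym/cvg_lim => //.
    by apply: cvg_nnsfun_approx.
  - by move=> n; apply/measurable_EFinP.
  - by move=> n y _ /=; rewrite lee_fin.
  - by move=> y _ a b ab; rewrite lee_fin; exact/lefP/nd_nnsfun_approx.
transitivity (lim (\int[mu]_x ((h n (F x))%:E * (w x)%:E) @[n --> \oo]));
    last first.
  rewrite -monotone_convergence//.
  - apply: eq_integral => x _; apply/cvg_lim => //.
    by apply: cvgeZr => //; apply: (cvg_nnsfun_approx measurableT mg).
  - move=> n; apply/emeasurable_funM; apply/measurable_EFinP => //.
    by apply: measurableT_comp.
  - by move=> n x _; rewrite mule_ge0 ?lee_fin.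
  - move=> x _ a b ab; rewrite lee_wpmul2r ?lee_fin//.
    exact/lefP/nd_nnsfun_approx.
congr (limn _); apply/funext => n.
transitivity (\int[nu]_y
   (\sum_(r \in range (h n)) (r * \1_(h n @^-1` [set r]) y)%:E)).
  by apply: eq_integral => t _; rewrite /= fimfunE -fsumEFin.
rewrite ge0_integral_fsum//; last 2 first.
  - by move=> r; apply/measurable_EFinP/measurable_funM.
  - by move=> r y _; exact: nnfun_muleindic_ge0.
transitivity (\int[mu]_x (\sum_(r \in range (h n))
    (r * \1_(h n @^-1` [set r]) (F x))%:E * (w x)%:E)); last first.
  apply: eq_integral => x _; rewrite -ge0_mule_fsuml => [|r].
    by rewrite fsumEFin// -(fimfunE _ (F x)).
  exact: nnfun_muleindic_ge0.
have mi r :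
    measurable_fun setT (fun x => (r * \1_(h n @^-1` [set r]) (F x))%:E).
  apply/measurable_EFinP/measurable_funM => //.
  by apply: measurableT_comp.
rewrite ge0_integral_fsum//; last 2 first.
  - by move=> r; apply: emeasurable_funM => //; exact/measurable_EFinP.
  - by move=> r x _; rewrite mule_ge0 ?lee_fin//; exact: nnfun_muleindic_ge0.
apply: eq_fsbigr => r rhn.
under eq_integral do rewrite EFinM.
rewrite integralZl_indic_nnsfun// integral_indic// setIT.
have r0 : (0 <= r)%R by move: rhn; rewrite inE => -[y _ <-].
rewrite nuE; last exact: measurable_sfunP.
rewrite integral_mkcond.
under [RHS]eq_integral do rewrite EFinM -muleA.
rewrite ge0_integralZl//; last 2 first.
  - apply: emeasurable_funM; apply/measurable_EFinP => //.
    by apply: measurableT_comp.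
  - by move=> x _; rewrite mule_ge0 ?lee_fin.
congr (_ * _); apply: eq_integral => x _.
rewrite patchE indicE.
have -> : (x \in F @^-1` (h n @^-1` [set r])) = (F x \in h n @^-1` [set r]).
  by apply/idP/idP; rewrite !inE.
by case: ifP => _; rewrite ?mul1e ?mul0e.
Qed.

End Substitution.

Section LebesgueSubstitution.
Variable R : realType.
Local Notation mu := (@lebesgue_measure R).
Variables F w : R -> R.
Hypothesis dF : forall x : R, is_derive x 1 F (w x).

Lemma is_derive_continuous : continuous F.
Proof. by move=> x; apply/differentiable_continuous/derivable1_diffP. Qed.

Lemma is_derive_gt0_lt : (forall x, 0 < w x) -> {mono F : x y / x < y}.
Proof.
move=> w0; apply: leW_mono; apply: le_mono => x y xy.
apply: (@gtr0_derive1_lt_cc _ F x y) => //.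
- by move=> z _; rewrite derive1E derive_val.
- exact/continuous_subspaceT/is_derive_continuous.
- by rewrite in_itv/= lexx ltW.
- by rewrite in_itv/= lexx ltW.
Qed.

Hypothesis cw : continuous w.
Hypothesis w0 : forall x, 0 < w x.

(** The fundamental theorem of calculus, put on half-open intervals because those are the sets on
    which [lebesgue_measure_unique] compares two measures. *)
Lemma integral_deriv_itvoc (x y : R) : x < y ->
  (\int[mu]_(t in `]x, y]) (w t)%:E = (F y - F x)%:E)%E.
Proof.
move=> xy; rewrite integral_itv_obnd_cbnd; last first.
  apply/measurable_EFinP; apply: measurable_funTS.
  exact: continuous_measurable_fun.
rewrite (@continuous_FTC2 _ w F) ?EFinB//.
- exact: continuous_subspaceT.
- split=> [z _||].
  + by [].
  + by apply: cvg_at_right_filter; exact: is_derive_continuous.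
  + by apply: cvg_at_left_filter; exact: is_derive_continuous.
- by move=> z _; rewrite derive1E derive_val.
Qed.

Local Open Scope ereal_scope.

Lemma ge0_integral_lebesgue_substitution : (forall y, exists x, F x = y) ->
  forall g : R -> \bar R, measurable_fun setT g -> (forall y, 0 <= g y) ->
  \int[mu]_y g y = \int[mu]_x (g (F x) * (w x)%:E).
Proof.
move=> surjF.
have mF : measurable_fun setT F.
  by apply: continuous_measurable_fun; exact: is_derive_continuous.
have mw : measurable_fun setT w by apply: continuous_measurable_fun.
have mFA (A : set R) : measurable A -> measurable (F @^-1` A).
  by move=> mA; rewrite -[X in measurable X]setTI; exact: mF.
(* The image under [F] of the measure with density [w]; agreement on half-open intervals identifies
   it with Lebesgue measure. *)
pose nu (A : set (measurableTypeR R)) : \bar R :=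
  \int[mu]_(x in F @^-1` A) (w x)%:E.
have nu0 : nu set0 = 0 by rewrite /nu preimage_set0 integral_set0.
have nu_ge0 A : 0 <= nu A.
  by apply: integral_ge0 => x _; rewrite lee_fin; exact: ltW.
have nu_sig : semi_sigma_additive nu.
  move=> A mA tA mUA; rewrite /nu preimage_bigcup ge0_integral_bigcup//.
  - apply: is_cvg_ereal_nneg_natsum_cond => n _ _.
    by apply: integral_ge0 => x _; rewrite lee_fin; exact: ltW.
  - by move=> k; apply: mFA; exact: mA.
  - by apply/measurable_EFinP; apply: measurable_funTS.
  - by move=> x _; rewrite lee_fin; exact: ltW.
  - apply/trivIsetP => i j _ _ ij; rewrite -preimage_setI.
    by move/trivIsetP : tA => ->//; rewrite preimage_set0.
pose nu_mix := isMeasure.Build _ _ _ nu nu0 nu_ge0 nu_sig.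
pose nuM : {measure set (measurableTypeR R) -> \bar R} := HB.pack nu nu_mix.
have nuE A : measurable A -> mu A = nu A.
  move=> mA; apply: (@lebesgue_measure_unique R nuM) => // _ [[a b]] _ <- /=.
  rewrite lebesgue_measure_itv/= lte_fin.
  (* Surjectivity supplies preimages of the endpoints, and strict monotonicity makes the preimage of
     []F x, F y]] exactly []x, y]]. *)
  have [x Fx] := surjF a; have [y Fy] := surjF b.
  rewrite /nu -Fx -Fy (is_derive_gt0_lt w0).
  have -> : F @^-1` [set` `]F x, F y]%R] = [set` `]x, y]%R].
    apply/seteqP; split => t /=; rewrite !in_itv/= !(is_derive_gt0_lt w0);
      by rewrite !leNgt !(is_derive_gt0_lt w0).
  case: ltP => xy; first by rewrite integral_deriv_itvoc// EFinB.
  by rewrite set_itv_ge ?integral_set0// bnd_simp -leNgt.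
move=> g mg g0.
apply: (ge0_integral_substitution (mu := mu) (nu := mu) (F := F) (w := w)) => //.
by move=> x; exact: ltW.
Qed.

End LebesgueSubstitution.

(** * The lift of the Moebius map *)

Section Expi.
Variable R : realType.
Implicit Types (s t : R) (n : int).

Lemma conjC_complex (x y : R) : (x +i* y)^* = x -i* y.
Proof. by []. Qed.

Lemma conjC_real_complex (x : R) : (x%:C)^* = x%:C.
Proof. by rewrite conjC_complex oppr0. Qed.

Lemma expi0 : expi (0 : R) = 1.
Proof. by rewrite /expi cos0 sin0. Qed.

Lemma expiD s t : expi (s + t) = expi s * expi t.
Proof.
by rewrite /expi cosD sinD; simpc; congr (_ +i* _); rewrite addrC.
Qed.

Lemma expiN t : expi (- t) = (expi t)^*.
Proof. by rewrite /expi cosN sinN. Qed.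

Lemma expiDpi t : expi (t + pi) = - expi t.
Proof. by rewrite /expi cosDpi sinDpi. Qed.

Lemma expiD2pi t : expi (t + 2 * pi) = expi t.
Proof. by rewrite /expi mulr_natl cosD2pi sinD2pi. Qed.

Lemma expi_mulVr t : expi t * expi (- t) = 1.
Proof. by rewrite -expiD subrr expi0. Qed.

Lemma expi_neq0 t : expi t != 0.
Proof.
apply/negP => /eqP E; have := expi_mulVr t.
by rewrite E mul0r => /esym/eqP; rewrite oner_eq0.
Qed.

Lemma expiV t : (expi t)^-1 = expi (- t).
Proof. by apply: (mulfI (expi_neq0 t)); rewrite expi_mulVr divff ?expi_neq0. Qed.

Lemma normc_expi t : Normc.normc (expi t) = 1.
Proof. by rewrite /= cos2Dsin2 sqrtr1. Qed.

Lemma expi_exprn t (n : nat) : expi t ^+ n = expi (n%:R * t).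
Proof.
elim: n => [|n IH]; first by rewrite mul0r expi0 expr0.
by rewrite exprS IH -expiD -[in RHS]natr1 mulrDl mul1r addrC.
Qed.

Lemma expi_exprz t n : expi t ^ n = expi (n%:~R * t).
Proof.
case: n => n; first by rewrite -exprnP expi_exprn.
by rewrite NegzE -exprnN expi_exprn expiV mulrNz mulNr.
Qed.

End Expi.

Section MoebiusLift.
Variables (R : realType) (rho zeta : R).
Hypotheses (rho_ge0 : 0 <= rho) (rho_lt1 : rho < 1).

(* Writing v = 1 - a^* e^{it}, which has positive real part, the Moebius map
   sends e^{it} to - e^{it} v^* / v, whose argument is t + pi - 2 arg v. *)
Definition moebius_lift (t : R) : R :=
  t + pi + 2 * atan (rho * sin (t - zeta) / (1 - rho * cos (t - zeta))).

(** The Poisson kernel of the disk at [a]: the denominator is [|1 - rho e^{i(t - zeta)}|^2], so this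
    is the multiplier of [Jhalf a] read along [expi]. *)
Definition moebius_jac (t : R) : R :=
  (1 - rho ^+ 2) / (1 - 2 * rho * cos (t - zeta) + rho ^+ 2).

Let a : R[i] := rho%:C * expi zeta.

Lemma moebius_den_gt0 t : 0 < 1 - rho * cos t.
Proof.
rewrite subr_gt0 (le_lt_trans _ rho_lt1)//.
by rewrite -[leRHS]mulr1 ler_wpM2l// cos_le1.
Qed.

Lemma moebius_jac_den_gt0 t : 0 < 1 - 2 * rho * cos t + rho ^+ 2.
Proof.
have := moebius_den_gt0 t => h.
have := cos2Dsin2 t => h2.
have -> : 1 - 2 * rho * cos t + rho ^+ 2 =
    (1 - rho * cos t) ^+ 2 + (rho * sin t) ^+ 2.
  by rewrite exprMn [sin t ^+ 2]sin2cos2; ring.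
by rewrite ltr_pwDl ?sqr_ge0 ?exprn_gt0.
Qed.

Lemma moebius_jac_gt0 t : 0 < moebius_jac t.
Proof.
by rewrite divr_gt0 ?moebius_jac_den_gt0// subr_gt0 expr_lt1.
Qed.

(** The right-hand side is [(1 + iq) / (1 - iq)]. For [q = - Im v / Re v] it equals [v^* / v], the
    unimodular factor in the Moebius map. *)
Lemma expi_atan2 (q : R) :
  expi (2 * atan q) = ((1 - q ^+ 2) / (1 + q ^+ 2)) +i* (2 * q / (1 + q ^+ 2)).
Proof.
have q0 : 1 + q ^+ 2 != 0 by rewrite gt_eqF// ltr_pwDl// sqr_ge0.
have c2 : cos (atan q) ^+ 2 = (1 + q ^+ 2)^-1.
  by rewrite cos_atan exprVn sqr_sqrtr// addr_ge0// sqr_ge0.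
have sE : sin (atan q) = q * cos (atan q).
  rewrite -{2}(atanK q) /tan divfK//.
  by apply: contra_eq_neq c2 => ->; rewrite expr0n/= eq_sym invr_eq0.
rewrite /expi mulr_natl cos_mulr2n sin_mulr2n sE.
congr (_ +i* _).
  by rewrite c2; field.
by rewrite mulrCA -expr2 c2 -mulr_natl; field.
Qed.

Lemma moebius_expi t : moebius a (expi t) = expi (moebius_lift t).
Proof.
rewrite /moebius_lift expiD expiDpi expi_atan2.
set u := t - zeta; have -> : t = zeta + u by rewrite /u; ring.
have h := moebius_den_gt0 u.
have D0 : 0 < (1 - rho * cos u) ^+ 2 + (rho * sin u) ^+ 2.
  by rewrite ltr_pwDl ?sqr_ge0 ?exprn_gt0.
rewrite /moebius /a expiD.
have -> : (rho%:C * expi zeta)^* * (expi zeta * expi u) = rho%:C * expi u.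
  by rewrite rmorphM /= conjC_real_complex -expiN -mulrA
    (mulrA (expi (- zeta))) (mulrC (expi (- _))) expi_mulVr mul1r.
have v0 : rho%:C * expi u - 1 != 0.
  by rewrite /expi eq_complex; simpc => /=; rewrite negb_and lt_eqF//; lra.
apply: (mulIf v0); rewrite mulfVK//.
set X := (X in - (expi zeta * expi u) * X).
(* Up to a sign on both sides this is [X v = v^*] for [v = 1 - rho e^{iu}], the rotation by [zeta]
   having been removed. *)
have K : X * (rho%:C * expi u - 1) = rho%:C * expi (- u) - 1.
  rewrite /X expiN /expi conjC_complex; simpc.
  by congr (_ +i* _); field; rewrite ?(gt_eqF D0) ?(gt_eqF h).
rewrite -mulrA K.
transitivity (expi zeta * expi u - rho%:C * expi zeta * (expi u * expi (- u))).
  by rewrite expi_mulVr mulr1.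
by ring.
Qed.

(** With [q] the argument of [atan], the derivative is [1 + 2 q' / (1 + q^2)], and [1 + q^2] is the
    denominator of [moebius_jac] over [(1 - rho cos (t - zeta))^2]. *)
Lemma is_derive_moebius_lift (t : R) :
  is_derive t 1 moebius_lift (moebius_jac t).
Proof.
have h := moebius_den_gt0 (t - zeta).
have D0 := moebius_jac_den_gt0 (t - zeta).
have d1 : is_derive t 1 (fun t => t - zeta) 1.
  by apply: is_derive_eq; rewrite subr0.
have ds : is_derive t 1 (fun t => sin (t - zeta)) (cos (t - zeta)).
  by have := is_derive1_comp (is_derive_sin _) d1; rewrite mulr1.
have dc : is_derive t 1 (fun t => cos (t - zeta)) (- sin (t - zeta)).
  by have := is_derive1_comp (is_derive_cos _) d1; rewrite mulr1.
have dd : is_derive t 1 (fun t => 1 - rho * cos (t - zeta))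
    (rho * sin (t - zeta)).
  apply: is_derive_eq.
  by rewrite /GRing.scale/=; ring.
have dv : is_derive t 1 (fun t => (1 - rho * cos (t - zeta))^-1)
   (- (1 - rho * cos (t - zeta)) ^- 2 * (rho * sin (t - zeta))).
  by apply: is_deriveV => //; rewrite gt_eqF.
have dq : is_derive t 1
    (fun t => rho * sin (t - zeta) / (1 - rho * cos (t - zeta)))
    ((rho * cos (t - zeta) - rho ^+ 2) / (1 - rho * cos (t - zeta)) ^+ 2).
  apply: is_derive_eq.
  rewrite /GRing.scale/=.
  have := sin2cos2 (t - zeta) => cs.
  transitivity ((rho * cos (t - zeta) * (1 - rho * cos (t - zeta))
      - rho ^+ 2 * sin (t - zeta) ^+ 2) / (1 - rho * cos (t - zeta)) ^+ 2).
    by field; rewrite gt_eqF.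
  by rewrite cs; field; rewrite gt_eqF.
have da := is_derive1_comp (is_derive1_atan _) dq.
have dl : is_derive t 1 (fun t => t + pi) 1.
  by apply: is_derive_eq; rewrite addr0.
apply: (is_derive_eq (is_deriveD dl (is_deriveZ 2 da))).
rewrite /GRing.scale/= /moebius_jac exprMn exprVn exprMn sin2cos2; field.
by rewrite (gt_eqF h) (gt_eqF D0).
Qed.

End MoebiusLift.

(** * The self-map of [[0, 2 pi]] induced by the lift *)

Section MoebiusArg.
Variables (R : realType) (rho zeta : R).
Hypotheses (rho_ge0 : 0 <= rho) (rho_lt1 : rho < 1).
Local Notation mu := (@lebesgue_measure R).
Local Notation circ := (@period R).
Local Notation lift := (moebius_lift rho zeta).
Local Notation jac := (moebius_jac rho zeta).

Lemma continuous_moebius_jac : continuous jac.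
Proof.
move=> t; apply: cvgM; first exact: cvg_cst.
apply: cvgV; first by rewrite gt_eqF// moebius_jac_den_gt0.
apply: cvgD; last exact: cvg_cst.
apply: cvgB; first exact: cvg_cst.
apply: cvgM; first exact: cvg_cst.
apply: (@continuous_comp _ _ _ (fun t => t - zeta) cos);
  last exact: continuous_cos.
by apply: cvgB; [exact: cvg_id|exact: cvg_cst].
Qed.

(** The extreme case is [cos = 1] here and [cos = -1] in [moebius_jac_ge]. The upper bound serves
    the norm of [J_a^{1/2} M_a], the lower one the norm of [P M_a] and the transport of null
    sets. *)
Lemma moebius_jac_le t : jac t <= (1 - rho ^+ 2) / (1 - rho) ^+ 2.
Proof.
apply: ler_wpM2l; first by rewrite subr_ge0 exprn_ile1// ltW.
rewrite lef_pV2 ?posrE ?moebius_jac_den_gt0 ?exprn_gt0 ?subr_gt0//.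
have := ler_wpM2l rho_ge0 (cos_le1 (t - zeta)); lra.
Qed.

Lemma moebius_jac_ge t : (1 - rho ^+ 2) / (1 + rho) ^+ 2 <= jac t.
Proof.
apply: ler_wpM2l; first by rewrite subr_ge0 exprn_ile1// ltW.
rewrite lef_pV2 ?posrE ?moebius_jac_den_gt0 ?exprn_gt0 ?ltr_pwDl//.
have := ler_wpM2l rho_ge0 (cos_geN1 (t - zeta)); lra.
Qed.

Lemma moebius_jac_measurable D : measurable_fun D jac.
Proof.
apply: measurable_funTS; apply: continuous_measurable_fun.
exact: continuous_moebius_jac.
Qed.

(** The arctangent stays strictly between [- pi / 2] and [pi / 2]. Hence one subtraction of [2 pi]
    brings the lift of a point of [[0, 2 pi]] back there, and [lift (y - 2 pi) < y < lift y] gives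
    surjectivity. *)
Lemma moebius_lift_bound t : t < lift t < t + 2 * pi.
Proof.
rewrite /moebius_lift; set q := atan _.
have h1 : - (pi / 2) < q by exact: atan_gtNpi2.
have h2 : q < pi / 2 by exact: atan_ltpi2.
by apply/andP; split; lra.
Qed.

Lemma moebius_liftD2pi t : lift (t + 2 * pi) = lift t + 2 * pi.
Proof.
rewrite /moebius_lift.
have -> : t + 2 * pi - zeta = t - zeta + pi *+ 2 by rewrite -mulr_natl; ring.
by rewrite cosD2pi sinD2pi; ring.
Qed.

Lemma moebius_lift_mono : {mono lift : x y / x < y}.
Proof.
apply: (is_derive_gt0_lt (w := jac)).
  by move=> x; exact: is_derive_moebius_lift.
by move=> x; exact: moebius_jac_gt0.
Qed.

Lemma continuous_moebius_lift : continuous lift.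
Proof.
apply: (is_derive_continuous (w := jac)).
by move=> x; exact: is_derive_moebius_lift.
Qed.

Lemma moebius_lift_surj y : exists x, lift x = y.
Proof.
have := moebius_lift_bound (y - 2 * pi) => /andP[_ h1].
have := moebius_lift_bound y => /andP[h2 _].
have p0 := @pi_gt0 R.
have [|||c _ <-] := @IVT R lift (y - 2 * pi) y y.
- by lra.
- exact/continuous_subspaceT/continuous_moebius_lift.
- by rewrite ge_min le_max (ltW h2) orbT andbT; apply/orP; left; lra.
by exists c.
Qed.

(** For [t] in [[0, 2 pi]] the lift lies in []0, 4 pi[], so the values fall in []0, 2 pi]]. For
    other [t] one turn may be the wrong amount, hence the restrictions to [period] below. *)
Definition moebius_arg (t : R) : R :=
  if lift t <= 2 * pi then lift t else lift t - 2 * pi.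

Local Notation arg := moebius_arg.

Lemma expi_moebius_arg t :
  expi (arg t) = moebius (rho%:C * expi zeta) (expi t).
Proof.
rewrite moebius_expi// /moebius_arg; case: ifP => // _.
by rewrite -expiD2pi subrK.
Qed.

Lemma moebius_arg_period t : circ t -> circ (arg t).
Proof.
rewrite /period/= !in_itv/= => /andP[t0 t2].
have p0 := @pi_gt0 R.
have /andP[h1 h2] := moebius_lift_bound t.
rewrite /moebius_arg; case: (leP (lift t)) => h3; first by apply/andP; split; lra.
by apply/andP; split; lra.
Qed.

Lemma moebius_arg_measurable D : measurable_fun D arg.
Proof.
have ml : measurable_fun setT lift.
  by apply: continuous_measurable_fun; exact: continuous_moebius_lift.
apply: measurable_funTS; apply: measurable_fun_ifT => //.
  exact: measurable_fun_ler.
exact: measurable_funB.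
Qed.

Local Open Scope ereal_scope.

Lemma ge0_integral_shift (g : R -> \bar R) (c : R) :
  measurable_fun setT g -> (forall y, 0 <= g y) ->
  \int[mu]_y g (y - c)%R = \int[mu]_y g y.
Proof.
move=> mg g0.
rewrite [RHS](@ge0_integral_lebesgue_substitution R (fun y => y - c)%R
  (fun=> 1%R))//.
- by apply: eq_integral => y _; rewrite mule1.
- by move=> x; apply: is_derive_eq; rewrite subr0.
- exact: cst_continuous.
- by move=> y; exists (y + c)%R; rewrite addrK.
Qed.

(** As [t] runs over [[0, 2 pi]], the lift runs over [[c, c + 2 pi]] with [c = lift 0]. The piece
    [[c, 2 pi]] is kept and []2 pi, c + 2 pi]] is shifted back to []0, c]]; together they cover the
    period up to a null set. *)
Lemma ge0_integral_moebius_arg (g : R -> \bar R) :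
  measurable_fun circ g -> (forall y, circ y -> 0 <= g y) ->
  \int[mu]_(t in circ) (g (arg t) * (jac t)%:E) = \int[mu]_(t in circ) g t.
Proof.
have mcirc : measurable circ by exact: measurable_itv.
(* Extension by zero: the substitution along the lift takes place on the whole line. *)
wlog : g / measurable_fun setT g /\ (forall y, 0 <= g y).
  move=> H mg g0.
  transitivity (\int[mu]_(t in circ) ((g \_ circ) (arg t) * (jac t)%:E)).
    apply: eq_integral => t; rewrite inE => tp.
    by rewrite patchE mem_set//; exact: moebius_arg_period.
  rewrite H.
  - by apply: eq_integral => t; rewrite patchE => ->.
  - split; first by apply/(measurable_restrictT _ mcirc).
    by move=> y; rewrite patchE; case: ifPn => //; rewrite inE => /g0.
  - by apply: measurable_funTS; apply/(measurable_restrictT _ mcirc).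
  - by move=> y; rewrite patchE; case: ifPn => //; rewrite inE => /g0.
move=> [mg g0] _ _.
have p0 := @pi_gt0 R.
set c := lift 0%R.
have /andP[c0 c2] := moebius_lift_bound 0%R; rewrite -/c add0r in c0 c2.
have c2pi : lift (2 * pi)%R = (c + 2 * pi)%R.
  by rewrite -[X in lift X]add0r moebius_liftD2pi.
(* [h1] and [h2] express the two pieces in terms of the unreduced lift; [h2] is supported on []2 pi,
   c + 2 pi]]. *)
pose h1 := g \_ `[c, (2 * pi)%R].
pose h2 s := (g \_ `]0%R, c]) (s - 2 * pi)%R.
have mI1 : measurable_fun setT (g \_ `[c, (2 * pi)%R]).
  by apply/(measurable_restrictT _ (measurable_itv _)); apply: measurable_funTS.
have mI2 : measurable_fun setT (g \_ `]0%R, c]).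
  by apply/(measurable_restrictT _ (measurable_itv _)); apply: measurable_funTS.
have h10 y : 0 <= h1 y by apply: erestrict_ge0.
have h20' y : 0 <= (g \_ `]0%R, c]) y by apply: erestrict_ge0.
have h20 y : 0 <= h2 y by exact: h20'.
have mh2 : measurable_fun setT h2.
  by apply: (measurableT_comp mI2); exact: measurable_funB.
transitivity (\int[mu]_x ((h1 \+ h2) (lift x) * (jac x)%:E)).
  rewrite integral_mkcond; apply: eq_integral => t _.
  rewrite patchE.
  have E0 : (0 <= t)%R = (c <= lift t)%R by rewrite leNgt -moebius_lift_mono -leNgt.
  have E1 : (t <= 2 * pi)%R = (lift t - 2 * pi <= c)%R.
    by rewrite lerBlDr -c2pi leNgt -moebius_lift_mono -leNgt.
  have -> : (t \in circ) = (c <= lift t)%R && (lift t - 2 * pi <= c)%R.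
    by apply/idP/idP; rewrite /period inE/= in_itv/= E0 E1.
  rewrite /h1 /h2 /= !patchE /moebius_arg.
  have -> : (lift t \in `[c, (2 * pi)%R]%classic) =
     (c <= lift t)%R && (lift t <= 2 * pi)%R.
    by apply/idP/idP; rewrite inE/= in_itv.
  have -> : ((lift t - 2 * pi)%R \in `]0%R, c]%classic) =
     (2 * pi < lift t)%R && (lift t - 2 * pi <= c)%R.
    by apply/idP/idP; rewrite inE/= in_itv/= subr_gt0.
  have [l2|l2] := leP (lift t) (2 * pi)%R.
    have -> : (lift t - 2 * pi <= c)%R.
      by apply: le_trans (ltW c0); rewrite subr_le0.
    by rewrite !andbT /= adde0; case: ifP => //; rewrite mul0e.
  have -> : (c <= lift t)%R by apply: le_trans (ltW l2); exact: ltW.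
  by rewrite /= add0e; case: ifP => //; rewrite mul0e.
rewrite -(@ge0_integral_lebesgue_substitution R lift jac _ _ _ _ (h1 \+ h2));
  last 6 first.
- by move=> x; exact: is_derive_moebius_lift.
- exact: continuous_moebius_jac.
- by move=> x; exact: moebius_jac_gt0.
- exact: moebius_lift_surj.
- exact: emeasurable_funD.
- by move=> y; exact: adde_ge0.
rewrite ge0_integralD// /h2 ge0_integral_shift// /h1 -!integral_mkcond.
(* Adjusting endpoints turns []0, c]] into [[0, c[], which is disjoint from [[c, 2 pi]] and
   completes it to the period. *)
rewrite integral_itv_obnd_cbnd; last exact: measurable_funTS.
rewrite -integral_itv_bndo_bndc; last exact: measurable_funTS.
rewrite addeC -ge0_integral_setU//=; last 2 first.
- exact: measurable_funTS.
- apply/disj_setPS => y [/=]; rewrite !in_itv/= => /andP[_ yc] /andP[].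
  by rewrite leNgt yc.
- rewrite /period -itv_bndbnd_setU// bnd_simp; exact: ltW.
Qed.

End MoebiusArg.

Lemma measurable_period (R : realType) : measurable (@period R).
Proof. exact: measurable_itv. Qed.

Section MoebiusArgTransfer.
Variables (R : realType) (rho zeta : R).
Hypotheses (rho_ge0 : 0 <= rho) (rho_lt1 : rho < 1).
Local Notation mu := (@lebesgue_measure R).
Local Notation circ := (@period R).
Local Notation jac := (moebius_jac rho zeta).
Local Notation arg := (moebius_arg rho zeta).

Let mcirc : measurable circ := @measurable_period R.

Lemma measurable_comp_moebius_arg d (T : measurableType d) (h : R -> T) :
  measurable_fun circ h -> measurable_fun circ (h \o arg).
Proof.
move=> mh; apply: (measurable_comp (F := circ)) => //.
- by move=> _ [t tp <-]; exact: moebius_arg_period.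
- exact: moebius_arg_measurable.
Qed.

Local Open Scope ereal_scope.

Lemma integral_moebius_arg (g : R -> \bar R) : measurable_fun circ g ->
  \int[mu]_(t in circ) (g (arg t) * (jac t)%:E) = \int[mu]_(t in circ) g t.
Proof.
move=> mg; rewrite integralE [RHS]integralE; congr (_ - _).
  rewrite -[RHS](@ge0_integral_moebius_arg R rho zeta)//;
    last exact: measurable_funepos.
  apply: eq_integral => t _; rewrite !funeposE muleC.
  by rewrite [RHS]muleC maxe_pMr ?lee_fin ?mule0// ltW// moebius_jac_gt0.
rewrite -[RHS](@ge0_integral_moebius_arg R rho zeta)//;
    last exact: measurable_funeneg.
apply: eq_integral => t _; rewrite !funenegE muleC -muleN.
by rewrite [RHS]muleC maxe_pMr ?lee_fin ?mule0// ltW// moebius_jac_gt0.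
Qed.

Lemma integrable_moebius_arg (h : R -> R) : mu.-integrable circ (EFin \o h) ->
  mu.-integrable circ (EFin \o (fun t => jac t * h (arg t))%R).
Proof.
move=> /integrableP[mh fh]; apply/integrableP; split.
  apply/measurable_EFinP; apply: measurable_funM.
    exact: moebius_jac_measurable.
  by apply: measurable_comp_moebius_arg; apply/measurable_EFinP.
rewrite -(@ge0_integral_moebius_arg R rho zeta) in fh => //; last first.
  exact: measurableT_comp.
apply: le_lt_trans fh; rewrite le_eqVlt; apply/orP; left; apply/eqP.
apply: eq_integral => t _ /=.
have j0 : (0 <= jac t)%R by apply/ltW/moebius_jac_gt0.
by rewrite normrM (ger0_norm j0) EFinM muleC.
Qed.

Lemma Rintegral_moebius_arg (h : R -> R) : measurable_fun circ h ->
  Rintegral mu circ (fun t => jac t * h (arg t))%R = Rintegral mu circ h.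
Proof.
move=> mh; rewrite /Rintegral; congr fine.
rewrite -(@integral_moebius_arg (EFin \o h)); last exact/measurable_EFinP.
by apply: eq_integral => t _; rewrite EFinM muleC.
Qed.

(** The change of variables with the density replaced by its lower bound. *)
Lemma ge0_integral_comp_moebius_arg_le (g : R -> \bar R) :
  measurable_fun circ g -> (forall y, circ y -> 0 <= g y) ->
  ((1 - rho ^+ 2) / (1 + rho) ^+ 2)%:E * \int[mu]_(t in circ) g (arg t) <=
  \int[mu]_(t in circ) g t.
Proof.
move=> mg g0; rewrite -[leRHS](@ge0_integral_moebius_arg R rho zeta)//.
have ga0 t : circ t -> 0 <= g (arg t).
  by move=> tp; apply: g0; exact: moebius_arg_period.
have mga : measurable_fun circ (fun t => g (arg t)).
  exact: measurable_comp_moebius_arg.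
rewrite -ge0_integralZl//; last first.
  by rewrite lee_fin divr_ge0 ?sqr_ge0// subr_ge0 exprn_ile1// ltW.
apply: ge0_le_integral => //.
- move=> t tp; rewrite mule_ge0 ?ga0// lee_fin divr_ge0 ?sqr_ge0//.
  by rewrite subr_ge0 exprn_ile1// ltW.
- exact: measurable_funeM.
- apply: emeasurable_funM => //; apply/measurable_EFinP.
  exact: moebius_jac_measurable.
- move=> t tp; rewrite muleC lee_wpmul2l ?ga0// lee_fin.
  exact: moebius_jac_ge.
Qed.

(** The previous inequality, applied to the indicator of a null set, shows that its preimage under
    [arg] is null. This makes composition with [M_a] well defined on classes. *)
Lemma ae_moebius_arg (P : R -> Prop) :
  {ae mu, forall t, circ t -> P t} -> {ae mu, forall t, circ t -> P (arg t)}.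
Proof.
case=> A [mA A0 PA].
exists (circ `&` arg @^-1` A); split.
- apply: moebius_arg_measurable => //.
- have k0 : (0 < (1 - rho ^+ 2) / (1 + rho) ^+ 2)%R.
    by apply: divr_gt0; rewrite ?subr_gt0 ?expr_lt1// exprn_gt0// ltr_pwDl.
  have mi : measurable_fun circ (fun t => (\1_A t : R)%:E).
    by apply/measurable_EFinP; apply: measurable_funTS; exact: measurable_indic.
  have H := @ge0_integral_comp_moebius_arg_le _ mi
    (fun t _ => ltac:(by rewrite lee_fin)).
  have EA : \int[mu]_(t in circ) (\1_A t : R)%:E = 0.
    apply/eqP; rewrite integral_indic// eq_le measure_ge0 andbT -A0.
    apply: le_measure; rewrite ?inE//; exact: measurableI.
  have EB : \int[mu]_(t in circ) (\1_A (arg t) : R)%:E =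
      mu (circ `&` arg @^-1` A).
    transitivity (\int[mu]_(t in circ) (\1_(arg @^-1` A) t : R)%:E) => //.
    rewrite integral_indic//; first by rewrite setIC.
    rewrite -[X in measurable X]setTI; exact: moebius_arg_measurable.
  rewrite EA EB in H; apply/eqP; rewrite eq_le measure_ge0 andbT.
  by rewrite -(@pmule_rle0 _ (((1 - rho ^+ 2) / (1 + rho) ^+ 2)%:E)).
- move=> t /= H.
  have [tp nP] : circ t /\ ~ P (arg t) by apply/not_implyP.
  split=> //=; apply: PA => /= Q; apply: nP; apply: Q.
  exact: moebius_arg_period.
Qed.

End MoebiusArgTransfer.

(** * Integrals on the circle *)

Section ComplexParts.
Variable R : realType.
Implicit Types (x y : R[i]) (r : R).
Local Notation Re := (@complex.Re R).
Local Notation Im := (@complex.Im R).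
Local Notation normc := (@Normc.normc R).

Lemma Re_add x y : Re (x + y) = Re x + Re y. Proof. by case: x; case: y. Qed.
Lemma Im_add x y : Im (x + y) = Im x + Im y. Proof. by case: x; case: y. Qed.
Lemma Re_opp x : Re (- x) = - Re x. Proof. by case: x. Qed.
Lemma Im_opp x : Im (- x) = - Im x. Proof. by case: x. Qed.
Lemma Re_mul x y : Re (x * y) = Re x * Re y - Im x * Im y.
Proof. by case: x; case: y. Qed.
Lemma Im_mul x y : Im (x * y) = Re x * Im y + Im x * Re y.
Proof. by case: x; case: y. Qed.
Lemma Re_real_mul r x : Re (r%:C * x) = r * Re x.
Proof. by rewrite Re_mul /= mul0r subr0. Qed.
Lemma Im_real_mul r x : Im (r%:C * x) = r * Im x.
Proof. by rewrite Im_mul /= mul0r addr0. Qed.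
Lemma Re_conj x : Re x^* = Re x. Proof. by case: x. Qed.
Lemma Im_conj x : Im x^* = - Im x. Proof. by case: x. Qed.
Lemma complex_ext x y : Re x = Re y -> Im x = Im y -> x = y.
Proof. by case: x => a b; case: y => c d /= -> ->. Qed.

Lemma sqr_normc_ReIm x : normc x ^+ 2 = Re x ^+ 2 + Im x ^+ 2.
Proof. by case: x => a b /=; rewrite sqr_sqrtr// addr_ge0 ?sqr_ge0. Qed.

Lemma normc_ge0 x : 0 <= normc x.
Proof. by case: x => a b /=; exact: sqrtr_ge0. Qed.

Lemma normr_Re_le x : `|Re x| <= normc x.
Proof.
rewrite -ler_sqr ?nnegrE ?normr_ge0 ?normc_ge0//.
by rewrite sqr_normc_ReIm real_normK ?num_real// lerDl sqr_ge0.
Qed.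

Lemma normr_Im_le x : `|Im x| <= normc x.
Proof.
rewrite -ler_sqr ?nnegrE ?normr_ge0 ?normc_ge0//.
by rewrite sqr_normc_ReIm real_normK ?num_real// lerDr sqr_ge0.
Qed.

Lemma normc_le_ReIm x : normc x <= `|Re x| + `|Im x|.
Proof.
rewrite -ler_sqr ?nnegrE ?normc_ge0 ?addr_ge0 ?normr_ge0// sqr_normc_ReIm.
rewrite -(real_normK (num_real (Re x))) -(real_normK (num_real (Im x))) sqrrD.
by rewrite lerD2r lerDl mulrn_wge0// mulr_ge0 ?normr_ge0.
Qed.

Lemma normcX x n : normc (x ^+ n) = normc x ^+ n.
Proof.
elim: n => [|n IH]; first by rewrite !expr0 Normc.normc1.
by rewrite !exprS Normc.normcM IH.
Qed.

Lemma normc_conj x : normc x^* = normc x.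
Proof. by case: x => a b /=; rewrite sqrrN. Qed.

Lemma normc_real_complex r : 0 <= r -> normc r%:C = r.
Proof. by move=> r0 /=; rewrite expr0n/= addr0 sqrtr_sqr ger0_norm. Qed.

End ComplexParts.

Section CircleInt.
Variable R : realType.
Local Notation mu := (@lebesgue_measure R).
Local Notation circ := (@period R).
Local Notation Re := (@complex.Re R).
Local Notation Im := (@complex.Im R).
Local Notation normc := (@Normc.normc R).
Implicit Types (f g : R[i] -> R[i]) (c : R[i]).

Let mcirc : measurable circ := @measurable_period R.

Definition circle_measurable f :=
  measurable_fun circ (fun t => Re (f (expi t))) /\
  measurable_fun circ (fun t => Im (f (expi t))).

Definition circle_integrable f :=
  mu.-integrable circ (EFin \o (fun t => Re (f (expi t)))) /\
  mu.-integrable circ (EFin \o (fun t => Im (f (expi t)))).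

Lemma eq_circle_int f g : (forall t, circ t -> f (expi t) = g (expi t)) ->
  circle_int f = circle_int g.
Proof.
move=> fg; rewrite /circle_int; congr (_ +i* _);
  by apply: eq_Rintegral => t; rewrite inE => /fg ->.
Qed.

Lemma integrableZlR (c : R) (h : R -> R) : mu.-integrable circ (EFin \o h) ->
  mu.-integrable circ (EFin \o (fun t => c * h t)).
Proof.
move=> hi; rewrite (_ : _ \o _ = (fun t => c%:E * (EFin \o h) t)%E)//.
exact: integrableZl.
Qed.

Lemma integrableDR (h k : R -> R) : mu.-integrable circ (EFin \o h) ->
  mu.-integrable circ (EFin \o k) ->
  mu.-integrable circ (EFin \o (fun t => h t + k t)).
Proof.
move=> hi ki; rewrite (_ : _ \o _ = ((EFin \o h) \+ (EFin \o k))%E)//.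
exact: integrableD.
Qed.

Lemma integrableBR (h k : R -> R) : mu.-integrable circ (EFin \o h) ->
  mu.-integrable circ (EFin \o k) ->
  mu.-integrable circ (EFin \o (fun t => h t - k t)).
Proof.
move=> hi ki; rewrite (_ : _ \o _ = ((EFin \o h) \- (EFin \o k))%E)//.
exact: integrableB.
Qed.

Lemma circle_intD f g : circle_integrable f -> circle_integrable g ->
  circle_int (fun x => f x + g x) = circle_int f + circle_int g.
Proof.
move=> [f1 f2] [g1 g2]; rewrite /circle_int.
apply: complex_ext => /=.
  by rewrite -RintegralD//; apply: eq_Rintegral => t _; rewrite Re_add.
by rewrite -RintegralD//; apply: eq_Rintegral => t _; rewrite Im_add.
Qed.

Lemma circle_integrableD f g : circle_integrable f -> circle_integrable g ->
  circle_integrable (fun x => f x + g x).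
Proof.
move=> [f1 f2] [g1 g2]; split.
  by under eq_fun do rewrite Re_add; exact: integrableDR.
by under eq_fun do rewrite Im_add; exact: integrableDR.
Qed.

Lemma circle_integrableZ c f : circle_integrable f ->
  circle_integrable (fun x => c * f x).
Proof.
move=> [f1 f2]; split.
  by under eq_fun do rewrite Re_mul; apply: integrableBR; exact: integrableZlR.
by under eq_fun do rewrite Im_mul; apply: integrableDR; exact: integrableZlR.
Qed.

Lemma circle_intZ c f : circle_integrable f ->
  circle_int (fun x => c * f x) = c * circle_int f.
Proof.
move=> [f1 f2]; rewrite /circle_int; apply: complex_ext.
  rewrite Re_mul /= -!RintegralZl// -RintegralB//; last 2 first.
    exact: (integrableZlR (Re c) f1).
    exact: (integrableZlR (Im c) f2).
  by apply: eq_Rintegral => t _; rewrite Re_mul.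
rewrite Im_mul /= -!RintegralZl// -RintegralD//; last 2 first.
  exact: (integrableZlR (Re c) f2).
  exact: (integrableZlR (Im c) f1).
by apply: eq_Rintegral => t _; rewrite Im_mul.
Qed.

Lemma circle_int_conj f : circle_integrable f ->
  circle_int (fun x => (f x)^*) = (circle_int f)^*.
Proof.
move=> [f1 f2]; rewrite /circle_int; apply: complex_ext.
  by rewrite Re_conj; apply: eq_Rintegral => t _; rewrite Re_conj.
rewrite Im_conj /= -[RHS]mulN1r -RintegralZl//.
by apply: eq_Rintegral => t _; rewrite Im_conj mulN1r.
Qed.

Lemma circle_integrable_measurable f : circle_integrable f -> circle_measurable f.
Proof.
by move=> [/integrableP[/measurable_EFinP f1 _]]
  /integrableP[/measurable_EFinP f2 _].
Qed.

Lemma ae_imply (P Q : R -> Prop) : {ae mu, forall t, P t} ->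
  (forall t, P t -> Q t) -> {ae mu, forall t, Q t}.
Proof.
move=> [A [mA A0 PA]] PQ; exists A; split=> //.
by apply: subset_trans PA => t /= nQ /PQ.
Qed.

Lemma ae_eq_circle_int f g : circle_measurable f -> circle_measurable g ->
  circle_ae_eq f g -> circle_int f = circle_int g.
Proof.
move=> [f1 f2] [g1 g2] fg; rewrite /circle_int /Rintegral.
congr (fine _ +i* fine _); apply: ae_eq_integral => //;
  try exact/measurable_EFinP;
  by apply: (ae_imply fg) => t H tp; rewrite H.
Qed.

Lemma mu_circ : mu circ = (2 * pi)%:E.
Proof.
by rewrite /period lebesgue_measure_itv/= lte_fin mulr_gt0 ?pi_gt0// oppr0 adde0.
Qed.

Lemma Rintegral_circ_cst (K : R) : Rintegral mu circ (fun=> K) = K * (2 * pi).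
Proof.
have E : fine (mu circ) = 2 * pi by rewrite mu_circ.
by rewrite -E; exact: Rintegral_cst.
Qed.

Lemma integrable_bounded (h : R -> R) (K : R) : measurable_fun circ h ->
  (forall t, `|h t| <= K) -> mu.-integrable circ (EFin \o h).
Proof.
move=> mh hK; apply: measurable_bounded_integrable => //.
- by have : (mu circ < +oo)%E by rewrite mu_circ ltry.
- exists K; split; first exact: num_real.
  by move=> M KM t _; apply: le_trans (ltW KM).
Qed.

Lemma circle_integrable_bounded f (K : R) : circle_measurable f ->
  (forall t, normc (f (expi t)) <= K) -> circle_integrable f.
Proof.
move=> [f1 f2] fK; split; apply: (@integrable_bounded _ K) => // t.
- exact: le_trans (normr_Re_le _) (fK t).
- exact: le_trans (normr_Im_le _) (fK t).
Qed.

Lemma Rintegral_bound (h : R -> R) (K : R) : measurable_fun circ h ->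
  (forall t, `|h t| <= K) -> `|Rintegral mu circ h| <= K * (2 * pi).
Proof.
move=> mh hK.
have ih := integrable_bounded mh hK.
apply: le_trans (le_normr_Rintegral _ ih) _ => //.
rewrite -Rintegral_circ_cst; apply: le_Rintegral => //.
- exact: integrable_norm.
- apply: (@integrable_bounded _ `|K|) => //; exact: measurable_cst.
Qed.

(** The constant is [4 pi] instead of [2 pi] because real and imaginary parts are bounded
    separately; the bound is only used for errors tending to 0 and for boundedness of entries. *)
Lemma circle_int_bound f (K : R) : circle_measurable f ->
  (forall t, normc (f (expi t)) <= K) -> normc (circle_int f) <= K * (4 * pi).
Proof.
move=> [f1 f2] fK; apply: le_trans (normc_le_ReIm _) _ => /=.
have -> : K * (4 * pi) = K * (2 * pi) + K * (2 * pi) by ring.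
apply: lerD; apply: Rintegral_bound => // t.
- exact: le_trans (normr_Re_le _) (fK t).
- exact: le_trans (normr_Im_le _) (fK t).
Qed.

Lemma circle_measurableM f g : circle_measurable f -> circle_measurable g ->
  circle_measurable (fun x => f x * g x).
Proof.
move=> [f1 f2] [g1 g2]; split.
  under eq_fun do rewrite Re_mul.
  by apply: measurable_funB; apply: measurable_funM.
under eq_fun do rewrite Im_mul.
by apply: measurable_funD; apply: measurable_funM.
Qed.

Lemma circle_measurableD f g : circle_measurable f -> circle_measurable g ->
  circle_measurable (fun x => f x + g x).
Proof.
move=> [f1 f2] [g1 g2]; split.
  under eq_fun do rewrite Re_add.
  exact: measurable_funD.
under eq_fun do rewrite Im_add.
exact: measurable_funD.
Qed.

Lemma circle_measurable_conj f : circle_measurable f ->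
  circle_measurable (fun x => (f x)^*).
Proof.
move=> [f1 f2]; split.
  by under eq_fun do rewrite Re_conj.
under eq_fun do rewrite Im_conj.
exact: measurableT_comp.
Qed.

Lemma circle_measurable_cst c : circle_measurable (fun=> c).
Proof. by split; exact: measurable_cst. Qed.

Lemma circle_measurable_exprz (n : int) : circle_measurable (fun x => x ^ n).
Proof.
have mn : measurable_fun setT (fun t : R => n%:~R * t) by exact: measurable_funM.
split.
  under eq_fun do rewrite expi_exprz.
  apply: measurable_funTS; apply: (measurableT_comp (f := cos) _ mn).
  by apply: continuous_measurable_fun; exact: continuous_cos.
under eq_fun do rewrite expi_exprz.
apply: measurable_funTS; apply: (measurableT_comp (f := sin) _ mn).
by apply: continuous_measurable_fun; exact: continuous_sin.
Qed.

Lemma normc_expi_exprz (n : int) (t : R) : normc (expi t ^ n) = 1.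
Proof. by rewrite expi_exprz normc_expi. Qed.

Lemma circle_integrable_exprz (n : int) : circle_integrable (fun x => x ^ n).
Proof.
apply: (@circle_integrable_bounded _ 1); first exact: circle_measurable_exprz.
by move=> t; rewrite normc_expi_exprz.
Qed.

Lemma circle_int_cst c : circle_int (fun=> c) = (2 * pi)%:C * c.
Proof.
apply: complex_ext.
  rewrite Re_mul /= mul0r subr0.
  by rewrite Rintegral_circ_cst mulrC.
rewrite Im_mul /= mul0r addr0.
by rewrite Rintegral_circ_cst mulrC.
Qed.

Lemma sin_intM2pi (n : int) : sin (n%:~R * (2 * pi) : R) = 0.
Proof.
have E : expi (n%:~R * (2 * pi) : R) = 1.
  rewrite -expi_exprz.
  by rewrite -[2 * pi]add0r expiD2pi expi0 exp1rz.
by case: E.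
Qed.

Lemma cos_intM2pi (n : int) : cos (n%:~R * (2 * pi) : R) = 1.
Proof.
have E : expi (n%:~R * (2 * pi) : R) = 1.
  rewrite -expi_exprz.
  by rewrite -[2 * pi]add0r expiD2pi expi0 exp1rz.
by case: E.
Qed.

Lemma Rintegral_deriv (F h : R -> R) : (forall t : R, is_derive t 1 F (h t)) ->
  continuous h -> Rintegral mu circ h = F (2 * pi) - F 0.
Proof.
move=> dF ch; rewrite /Rintegral /period.
rewrite (@continuous_FTC2 _ h F)//.
- by rewrite mulr_gt0 ?pi_gt0.
- exact: continuous_subspaceT.
- have cF : continuous F by exact: is_derive_continuous dF.
  split.
  + by [].
  + by apply: cvg_at_right_filter; exact: cF.
  + by apply: cvg_at_left_filter; exact: cF.
- by move=> z _; rewrite derive1E derive_val.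
Qed.

(** For [n] nonzero the antiderivatives [sin (n t) / n] and [- cos (n t) / n] take equal values at 0
    and [2 pi]. *)
Lemma circle_int_exprz (n : int) :
  circle_int (fun x : R[i] => x ^ n) = if n == 0 then (2 * pi)%:C else 0.
Proof.
case: eqP => [->|/eqP n0].
  transitivity (@circle_int R (fun=> 1)); first exact: eq_circle_int.
  by rewrite circle_int_cst mulr1.
have nR : n%:~R != 0 :> R by rewrite intr_eq0.
have dn (t : R) : is_derive t 1 (fun t : R => n%:~R * t) n%:~R.
  by apply: is_derive_eq; rewrite /GRing.scale/= mulr1.
have cn : continuous (fun t : R => n%:~R * t) by exact: is_derive_continuous dn.
apply: complex_ext => /=.
  transitivity (Rintegral mu circ (fun t => cos (n%:~R * t))).
    by apply: eq_Rintegral => t _; rewrite expi_exprz.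
  have dF (t : R) : is_derive t 1 (fun t : R => n%:~R^-1 * sin (n%:~R * t))
      (cos (n%:~R * t)).
    have d1 := is_derive1_comp (is_derive_sin _) (dn t).
    apply: (is_derive_eq (is_deriveZ n%:~R^-1 d1)).
    by rewrite /GRing.scale/=; field.
  rewrite (Rintegral_deriv dF).
    by rewrite sin_intM2pi !mulr0 sin0 mulr0 subr0.
  move=> t; apply: continuous_comp; [exact: cn|exact: continuous_cos].
transitivity (Rintegral mu circ (fun t => sin (n%:~R * t))).
  by apply: eq_Rintegral => t _; rewrite expi_exprz.
have dF (t : R) : is_derive t 1 (fun t : R => - n%:~R^-1 * cos (n%:~R * t))
    (sin (n%:~R * t)).
  have d1 := is_derive1_comp (is_derive_cos _) (dn t).
  apply: (is_derive_eq (is_deriveZ (- n%:~R^-1) d1)).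
  by rewrite /GRing.scale/=; field.
rewrite (Rintegral_deriv dF).
  by rewrite cos_intM2pi mulr0 cos0 subrr.
move=> t; apply: continuous_comp; [exact: cn|exact: continuous_sin].
Qed.

End CircleInt.

(** * Absolutely convergent power series on the circle *)

Section Wiener.
Variable R : realType.
Local Notation normc := (@Normc.normc R).
Implicit Types (f g : R[i] -> R[i]) (c d : nat -> R[i]).

(** On the circle, [f] belongs to the Wiener algebra, with Fourier coefficients [c] at nonnegative
    frequencies and none at negative ones. Absolute summability is a bound on partial sums, and [e]
    is a uniform rate of convergence. *)
Definition wiener f c : Prop :=
  (exists K : R, forall N, \sum_(k < N) normc (c k) <= K) /\
  (exists2 e : nat -> R, e @ \oo --> (0 : R) & forall N x, normc x = 1 ->
     normc (f x - \sum_(k < N) c k * x ^+ k) <= e N).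

Lemma eq_wiener f g c d : (forall x, normc x = 1 -> f x = g x) -> c =1 d ->
  wiener f c -> wiener g d.
Proof.
move=> fg cd [[K Kc] [e e0 ef]]; split.
  by exists K => N; under eq_bigr do rewrite -cd.
exists e => // N x x1; rewrite -fg//.
by under eq_bigr do rewrite -cd; exact: ef.
Qed.

Lemma wiener0 : wiener (fun=> 0) (fun=> 0).
Proof.
split.
  by exists 0 => N; rewrite big1// => k _; rewrite Normc.normc0.
exists (fun=> 0); first exact: cvg_cst.
by move=> N x _; rewrite big1 ?subr0 ?Normc.normc0// => k _; rewrite mul0r.
Qed.

Lemma wienerD f g c d : wiener f c -> wiener g d ->
  wiener (fun x => f x + g x) (fun k => c k + d k).
Proof.
move=> [[K Kc] [e e0 ef]] [[L Ld] [h h0 hg]]; split.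
  exists (K + L) => N; apply: le_trans (lerD (Kc N) (Ld N)).
  by rewrite -big_split/=; apply: ler_sum => k _; exact: le_normcD.
exists (fun N => e N + h N).
  by rewrite -[X in _ --> X]addr0; exact: cvgD.
move=> N x x1; apply: le_trans (lerD (ef N x x1) (hg N x x1)).
apply: le_trans (le_normcD _ _); rewrite le_eqVlt; apply/orP; left; apply/eqP.
under eq_bigr do rewrite mulrDl.
by rewrite big_split/=; congr normc; ring.
Qed.

Lemma wienerZ (a : R[i]) f c : wiener f c ->
  wiener (fun x => a * f x) (fun k => a * c k).
Proof.
move=> [[K Kc] [e e0 ef]]; split.
  exists (normc a * K) => N; under eq_bigr do rewrite Normc.normcM.
  by rewrite -mulr_sumr ler_wpM2l ?normc_ge0.
exists (fun N => normc a * e N).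
  by rewrite -[X in _ --> X](mulr0 (normc a)); apply: cvgM => //; exact: cvg_cst.
move=> N x x1; under eq_bigr do rewrite -mulrA.
by rewrite -mulr_sumr -mulrBr Normc.normcM ler_wpM2l ?normc_ge0 ?ef.
Qed.

Lemma wiener_sum n (f : nat -> R[i] -> R[i]) (c : nat -> nat -> R[i]) :
  (forall i, (i < n)%N -> wiener (f i) (c i)) ->
  wiener (fun x => \sum_(i < n) f i x) (fun k => \sum_(i < n) c i k).
Proof.
elim: n => [|n IH] H.
  by apply: eq_wiener wiener0 => [x _|k]; rewrite big_ord0.
have W := wienerD (IH (fun i ni => H i (ltnW ni))) (H n (ltnSn n)).
by apply: eq_wiener W => [x _|k]; rewrite big_ord_recr.
Qed.

Lemma wiener_shift i f c : wiener f c ->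
  wiener (fun x => x ^+ i * f x) (fun k => if (i <= k)%N then c (k - i)%N else 0).
Proof.
move=> [[K Kc] [e e0 ef]]; split.
  (* The subtraction is truncated: for [N <= i] all coefficients below [N] are zero, and the sum
     over [N - i] terms is empty. *)
  exists K => N; apply: le_trans (Kc (N - i)%N).
  rewrite le_eqVlt; apply/orP; left; apply/eqP.
  elim: N => [|N IH]; first by rewrite !big_ord0.
  rewrite big_ord_recr/= IH; case: leqP => iN.
    by rewrite subSn// big_ord_recr.
  by rewrite Normc.normc0 addr0 (eqP (ltnW iN)) (eqP iN).
exists (fun N => e (N - i)%N).
  rewrite -(cvg_shiftn i) (_ : (fun n => _) = e)//.
  by apply/funext => n; rewrite addnK.
move=> N x x1.
rewrite (_ : \sum_(k < N) _ = x ^+ i * \sum_(k < N - i) c k * x ^+ k).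
  by rewrite -mulrBr Normc.normcM normcX x1 expr1n mul1r; exact: ef.
elim: N => [|N IH]; first by rewrite !big_ord0 mulr0.
rewrite big_ord_recr/= IH; case: leqP => iN.
  by rewrite subSn// big_ord_recr/= mulrDr mulrCA -exprD subnKC.
by rewrite mul0r addr0 (eqP (ltnW iN)) (eqP iN).
Qed.

(** * The negative binomial series *)

Section NegBinomial.
Variable r : R.
Hypotheses (r0 : 0 <= r) (r1 : r < 1).

(** Pascal's rule in summed form. It lowers the exponent [p] by one at the price of a boundary term,
    which drives the inductions below. *)
Lemma negbin_telescope (A : comPzRingType) (z : A) p N :
  (1 - z) * \sum_(j < N) 'C(p.+1 + j, p.+1)%:R * z ^+ j =
  \sum_(j < N) 'C(p + j, p)%:R * z ^+ j - 'C(p + N, p.+1)%:R * z ^+ N.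
Proof.
elim: N => [|N IH].
  by rewrite !big_ord0 addn0 bin_small// mulr0 mul0r subrr.
rewrite !big_ord_recr/= mulrDr IH addSn addnS !binS !natrD exprS; ring.
Qed.

Lemma geom_telescope (A : comPzRingType) (z : A) N :
  (1 - z) * \sum_(j < N) 'C(0 + j, 0)%:R * z ^+ j = 1 - z ^+ N.
Proof.
elim: N => [|N IH]; first by rewrite big_ord0 mulr0 expr0 subrr.
by rewrite big_ord_recr/= mulrDr IH bin0 exprS; ring.
Qed.

Lemma negbin_sum_bound p :
  exists K : R, forall N, \sum_(j < N) 'C(p + j, p)%:R * r ^+ j <= K.
Proof.
have q0 : 0 < 1 - r by rewrite subr_gt0.
elim: p => [|p [K IH]].
  exists (1 - r)^-1 => N; rewrite -[leRHS]mul1r ler_pdivlMr// mulrC.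
  by rewrite geom_telescope lerBlDr lerDl exprn_ge0.
exists (K / (1 - r)) => N; rewrite ler_pdivlMr// mulrC negbin_telescope.
by rewrite lerBlDr (le_trans (IH N))// lerDl mulr_ge0// exprn_ge0.
Qed.

(** A bounded series of nonnegative terms converges, so its terms tend to 0; this disposes of the
    boundary terms. *)
Lemma negbin_cvg0 p : (fun N => 'C(p + N, p)%:R * r ^+ N) @ \oo --> (0 : R).
Proof.
have [K HK] := negbin_sum_bound p.
pose u N : R := 'C(p + N, p)%:R * r ^+ N.
have u0 N : 0 <= u N by rewrite mulr_ge0// exprn_ge0.
apply: (@cvg_series_cvg_0 _ _ u).
apply: nondecreasing_is_cvgn.
  by apply/nondecreasing_seqP => n; rewrite !seriesEnat/= big_nat_recr//= lerDl.
exists K => _ [N _ <-]; rewrite seriesEord/=; exact: HK.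
Qed.

(** Since [|1 - z| >= 1 - r], the error is at most [1 / (1 - r)] times its product with [1 - z],
    which telescoping reduces to the error for [p - 1] plus a boundary term. All estimates depend on
    [r] alone. *)
Lemma negbin_cvg p : exists2 e : nat -> R, e @ \oo --> (0 : R) &
  forall N (z : R[i]), normc z <= r ->
    normc ((1 - z) ^- p.+1 - \sum_(j < N) 'C(p + j, p)%:R * z ^+ j) <= e N.
Proof.
have q0 : 0 < 1 - r by rewrite subr_gt0.
have zq (z : R[i]) : normc z <= r -> 1 - r <= normc (1 - z).
  move=> zr; have := le_normcD (1 - z) z; rewrite subrK Normc.normc1; lra.
have z1 (z : R[i]) : normc z <= r -> 1 - z != 0.
  move=> zr; apply: contraTneq (lt_le_trans q0 (zq _ zr)) => ->.
  by rewrite Normc.normc0 ltxx.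
elim: p => [|p [e e0 IH]].
  exists (fun N => r ^+ N / (1 - r)).
    rewrite -[X in _ --> X](mul0r (1 - r)^-1); apply: cvgM; last exact: cvg_cst.
    by apply: cvg_expr; rewrite ger0_norm.
  move=> N z zr; rewrite ler_pdivlMr//.
  set S := \sum_(j < N) _.
  apply: (@le_trans _ _ (normc ((1 - z) ^-1 - S) * normc (1 - z))).
    by rewrite ler_wpM2l ?normc_ge0 ?zq.
  rewrite -Normc.normcM mulrC mulrBr geom_telescope divff ?z1//.
  rewrite (_ : _ - _ = z ^+ N); last by ring.
  by rewrite normcX lerXn2r ?nnegrE ?normc_ge0.
exists (fun N => (e N + 'C(p.+1 + N, p.+1)%:R * r ^+ N) / (1 - r)).
  rewrite -[X in _ --> X](mul0r (1 - r)^-1); apply: cvgM; last exact: cvg_cst.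
  rewrite -[X in _ --> X](addr0 (0 : R)); apply: cvgD => //.
  exact: negbin_cvg0.
move=> N z zr; rewrite ler_pdivlMr//.
set S := \sum_(j < N) _.
apply: (@le_trans _ _ (normc ((1 - z) ^- p.+2 - S) * normc (1 - z))).
  by rewrite ler_wpM2l ?normc_ge0 ?zq.
rewrite -Normc.normcM mulrC mulrBr negbin_telescope.
rewrite (_ : _ - _ = ((1 - z) ^- p.+1 - \sum_(j < N) 'C(p + j, p)%:R * z ^+ j)
   + 'C(p + N, p.+1)%:R * z ^+ N); last first.
  by rewrite [_ ^+ p.+2]exprS invfM mulVKf ?z1//; ring.
apply: le_trans (le_normcD _ _) _; apply: lerD; first exact: IH.
(* The boundary coefficient ['C(p + N, p.+1)] is replaced by the larger ['C(p.+1 + N, p.+1)], to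
   which [negbin_cvg0] applies. *)
rewrite Normc.normcM normcX ler_pM ?normc_ge0 ?exprn_ge0 ?normc_ge0//.
  rewrite (_ : 'C(p + N, p.+1)%:R = ('C(p + N, p.+1)%:R : R)%:C);
    last by rewrite rmorph_nat.
  by rewrite normc_real_complex// ler_nat addSn binS leq_addr.
by rewrite lerXn2r ?nnegrE ?normc_ge0.
Qed.

Lemma wiener_negbin (b : R[i]) p : normc b = r ->
  wiener (fun x => (1 - b * x) ^- p.+1) (fun j => 'C(p + j, p)%:R * b ^+ j).
Proof.
move=> br; split.
  have [K HK] := negbin_sum_bound p; exists K => N.
  apply: le_trans (HK N); apply: ler_sum => k _.
  rewrite Normc.normcM normcX br.
  rewrite (_ : 'C(p + k, p)%:R = ('C(p + k, p)%:R : R)%:C);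
    last by rewrite rmorph_nat.
  by rewrite normc_real_complex.
have [e e0 He] := negbin_cvg p; exists e => // N x x1.
have := He N (b * x); rewrite Normc.normcM x1 br mulr1 lexx => /(_ isT).
by under eq_bigr do rewrite exprMn mulrA.
Qed.

End NegBinomial.

(* The coefficient of x^m in (a - x)^n (1 - a^* x)^{-n}, for n > 0. *)
Definition moebius_coef (a : R[i]) (n m : nat) : R[i] :=
  \sum_(k < n.+1) if (n - k <= m)%N then
    (-1) ^+ (n - k) * 'C(k + m - 1, n - 1)%:R * 'C(n, k)%:R
      * (a ^+ k * a^* ^+ (k + m - n)) else 0.

(** Each term of the binomial expansion of [(a - x)^n] shifts and scales the negative binomial
    series in [a^* x]; the coefficients are collected over this finite sum. *)
Lemma wiener_moebius (a : R[i]) n : normc a < 1 -> (0 < n)%N ->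
  wiener (fun x => moebius a x ^+ n) (moebius_coef a n).
Proof.
move=> a1; case: n => // p _.
have W := wiener_negbin (normc_ge0 a) a1 p (normc_conj a).
pose co k : R[i] := (-1) ^+ (p.+1 - k) * 'C(p.+1, k)%:R * a ^+ k.
have V k := wienerZ (co k) (wiener_shift (p.+1 - k) W).
have := @wiener_sum p.+2 _ _ (fun k _ => V k).
apply: eq_wiener => [x x1|m].
  rewrite /moebius (_ : _ / _ = (a - x) * (1 - a^* * x)^-1); last first.
    by rewrite -mulrNN -invrN !opprB.
  (* Reversing the binomial sum makes [k] the exponent of [a], as in [moebius_coef], instead of the
     exponent of [x]. *)
  rewrite exprMn exprVn [(a - x) ^+ _]exprDn mulr_suml [RHS](reindex_inj rev_ord_inj)/=.
  apply: eq_bigr => k _.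
  rewrite subSS /co.
  have kp : (k <= p.+1)%N by rewrite -ltnS.
  rewrite (subKn kp) bin_sub// [(- x) ^+ _]exprNn -[_ *+ _]mulr_natr; ring.
rewrite /moebius_coef; apply: eq_bigr => k _.
have kp : (k <= p.+1)%N by rewrite -ltnS.
case: ifP => km; last by rewrite mulr0.
rewrite /co.
have -> : (p + (m - (p.+1 - k)) = k + m - 1)%N by lia.
have -> : (m - (p.+1 - k) = k + m - p.+1)%N by lia.
by rewrite subSS subn0; ring.
Qed.

End Wiener.

(** * The operators *)

Section CircleL2Theory.
Variable R : realType.
Local Notation mu := (@lebesgue_measure R).
Local Notation circ := (@period R).
Local Notation Re := (@complex.Re R).
Local Notation Im := (@complex.Im R).
Local Notation normc := (@Normc.normc R).
Implicit Types (f g : R[i] -> R[i]).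
Let mcirc : measurable circ := @measurable_period R.

Definition sqr_modulus f (t : R) : R := normc (f (expi t)) ^+ 2.

Lemma sqr_modulus_ge0 f t : 0 <= sqr_modulus f t.
Proof. exact: sqr_ge0. Qed.

Lemma measurable_sqr_modulus f : circle_measurable f ->
  measurable_fun circ (sqr_modulus f).
Proof.
move=> [f1 f2]; rewrite /sqr_modulus.
under eq_fun do rewrite sqr_normc_ReIm.
by apply: measurable_funD; apply: measurable_funX.
Qed.

Lemma L2P f : L2 f <->
  circle_measurable f /\ mu.-integrable circ (EFin \o sqr_modulus f).
Proof.
split=> [[f1 f2 fy]|[[f1 f2] /integrableP[_ fy]]].
  split; first by [].
  apply/integrableP; split.
    by apply/measurable_EFinP; exact: measurable_sqr_modulus.
  by under eq_integral => t _ do rewrite /= ger0_norm ?sqr_modulus_ge0//.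
split=> //.
by move: fy; under eq_integral => t _ do rewrite /= ger0_norm ?sqr_modulus_ge0//.
Qed.

Lemma integrable_cstR (c : R) : mu.-integrable circ (EFin \o (fun=> c)).
Proof. by apply: (@integrable_bounded _ _ `|c|) => //; exact: measurable_cst. Qed.

Lemma integrable_dominatedR (h k : R -> R) : measurable_fun circ h ->
  (forall t, `|h t| <= `|k t|) -> mu.-integrable circ (EFin \o k) ->
  mu.-integrable circ (EFin \o h).
Proof.
move=> mh hk; apply: le_integrable => //; first exact/measurable_EFinP.
by move=> t _ /=; rewrite lee_fin.
Qed.

(** On a space of finite measure [|f| <= 1 + |f|^2] suffices; the inequality follows from
    [(|f| - 1/2)^2 >= 0]. *)
Lemma L2_circle_integrable f : L2 f -> circle_integrable f.
Proof.
move=> /L2P[[f1 f2] fi].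
have i1 : mu.-integrable circ (EFin \o (fun t => 1 + sqr_modulus f t)).
  by apply: integrableDR => //; exact: integrable_cstR.
have le1 t : normc (f (expi t)) <= `|1 + sqr_modulus f t|.
  rewrite ger0_norm ?addr_ge0 ?sqr_modulus_ge0// /sqr_modulus.
  by have := sqr_ge0 (normc (f (expi t)) - 2^-1); rewrite sqrrB; nra.
split; apply: (integrable_dominatedR _ _ i1) => // t; apply: le_trans (le1 t).
- exact: normr_Re_le.
- exact: normr_Im_le.
Qed.

Lemma L2normE f : L2norm f = Num.sqrt (Rintegral mu circ (sqr_modulus f)).
Proof.
congr Num.sqrt; apply: eq_Rintegral => t _.
by rewrite Re_mul Re_conj Im_conj mulrN opprK /sqr_modulus sqr_normc_ReIm !expr2.
Qed.

Definition circle_mean f : R[i] := ((2 * pi)^-1)%:C * circle_int f.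

Lemma twopi_neq0 : 2 * pi != 0 :> R.
Proof. by rewrite mulf_neq0 ?pnatr_eq0// gt_eqF// pi_gt0. Qed.

Lemma circle_int_mean f : circle_int f = (2 * pi)%:C * circle_mean f.
Proof.
by rewrite /circle_mean mulrA -rmorphM divff ?twopi_neq0// rmorph1 mul1r.
Qed.

Lemma circle_integrable_cst c : circle_integrable (fun=> c : R[i]).
Proof.
by apply: (@circle_integrable_bounded _ _ (normc c)).
Qed.

Lemma circle_int_Pproj f : circle_integrable f -> circle_int (Pproj f) = 0.
Proof.
move=> fi; rewrite /Pproj circle_intD//; last exact: circle_integrable_cst.
by rewrite circle_int_cst -/(circle_mean f) circle_int_mean mulrN subrr.
Qed.

Lemma sqr_modulus_Pproj f t : sqr_modulus (Pproj f) t =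
  sqr_modulus f t - (2 * Re (circle_mean f) * Re (f (expi t)) +
    2 * Im (circle_mean f) * Im (f (expi t))) + normc (circle_mean f) ^+ 2.
Proof.
rewrite /sqr_modulus /Pproj -/(circle_mean f) !sqr_normc_ReIm.
by rewrite Re_add Im_add Re_opp Im_opp; ring.
Qed.

Lemma L2_Pproj f : L2 f -> L2 (Pproj f).
Proof.
move=> fL; have [f1 f2] := L2_circle_integrable fL.
have [fm fi] := (L2P f).1 fL.
apply/L2P; split.
  apply: circle_measurableD => //; exact: circle_measurable_cst.
rewrite (_ : sqr_modulus _ = fun t => sqr_modulus f t -
    (2 * Re (circle_mean f) * Re (f (expi t)) +
    2 * Im (circle_mean f) * Im (f (expi t))) + normc (circle_mean f) ^+ 2).
  apply: integrableDR; last exact: integrable_cstR.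
  by apply: integrableBR => //; apply: integrableDR; exact: integrableZlR.
by apply/funext => t; exact: sqr_modulus_Pproj.
Qed.

(** Pythagoras: with [m] the mean of [f], the squared norm drops by [2 pi |m|^2]. *)
Lemma L2norm_Pproj f : L2 f -> L2norm (Pproj f) <= L2norm f.
Proof.
move=> fL; have [f1 f2] := L2_circle_integrable fL.
have [fm fi] := (L2P f).1 fL.
rewrite !L2normE ler_wsqrtr//.
set m := circle_mean f.
have E : Rintegral mu circ (sqr_modulus (Pproj f)) =
    Rintegral mu circ (sqr_modulus f) - (2 * Re m * (2 * pi * Re m) +
    2 * Im m * (2 * pi * Im m)) + normc m ^+ 2 * (2 * pi).
  have mE : circle_int f = (2 * pi * Re m) +i* (2 * pi * Im m).
    rewrite circle_int_mean -/m; apply: complex_ext.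
      exact: Re_real_mul.
    exact: Im_real_mul.
  have [<- <-] := mE.
  rewrite -!RintegralZl// -RintegralD//; last 2 first.
    exact: (integrableZlR (2 * Re m) f1).
    exact: (integrableZlR (2 * Im m) f2).
  rewrite -RintegralB//; last first.
    exact: (integrableDR (integrableZlR (2 * Re m) f1)
      (integrableZlR (2 * Im m) f2)).
  rewrite -Rintegral_circ_cst -RintegralD//; last 2 first.
    apply: integrableBR => //.
    exact: (integrableDR (integrableZlR (2 * Re m) f1)
      (integrableZlR (2 * Im m) f2)).
    exact: integrable_cstR.
  by apply: eq_Rintegral => t _; exact: sqr_modulus_Pproj.
rewrite E sqr_normc_ReIm.
have := @pi_gt0 R; have := sqr_ge0 (Re m); have := sqr_ge0 (Im m); nra.
Qed.

End CircleL2Theory.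

Section CircleMean.
Variable R : realType.
Local Notation normc := (@Normc.normc R).
Implicit Types (f g : R[i] -> R[i]) (n m : int).

Lemma circle_mean_bound f (K : R) : circle_measurable f ->
  (forall t, normc (f (expi t)) <= K) -> normc (circle_mean f) <= 2 * K.
Proof.
move=> fm fK; have p0 := @pi_gt0 R.
rewrite /circle_mean Normc.normcM normc_real_complex; last first.
  by rewrite invr_ge0 mulr_ge0 ?ltW.
rewrite mulrC ler_pdivrMr ?mulr_gt0//.
apply: le_trans (circle_int_bound fm fK) _.
by rewrite le_eqVlt; apply/orP; left; apply/eqP; ring.
Qed.

Lemma circle_meanD f g : circle_integrable f -> circle_integrable g ->
  circle_mean (fun x => f x + g x) = circle_mean f + circle_mean g.
Proof. by move=> fi gi; rewrite /circle_mean circle_intD// mulrDr. Qed.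

Lemma circle_meanZ (c : R[i]) f : circle_integrable f ->
  circle_mean (fun x => c * f x) = c * circle_mean f.
Proof. by move=> fi; rewrite /circle_mean circle_intZ// mulrCA. Qed.

Lemma eq_circle_mean f g : (forall t, f (expi t) = g (expi t)) ->
  circle_mean f = circle_mean g.
Proof. by move=> fg; congr (_ * _); apply: eq_circle_int => t _. Qed.

Lemma circle_integrable_sum (c : nat -> R[i]) (F : nat -> R[i] -> R[i]) N :
  (forall k, circle_integrable (F k)) ->
  circle_integrable (fun x => \sum_(k < N) c k * F k x).
Proof.
move=> Fi; elim: N => [|N IH].
  rewrite (_ : (fun x => _) = fun=> 0); first exact: circle_integrable_cst.
  by apply/funext => x; rewrite big_ord0.
rewrite (_ : (fun x => _) = fun x => \sum_(k < N) c k * F k x + c N * F N x).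
  by apply: circle_integrableD => //; exact: circle_integrableZ.
by apply/funext => x; rewrite big_ord_recr.
Qed.

Lemma circle_mean_sum (c : nat -> R[i]) (F : nat -> R[i] -> R[i]) N :
  (forall k, circle_integrable (F k)) ->
  circle_mean (fun x => \sum_(k < N) c k * F k x) =
  \sum_(k < N) c k * circle_mean (F k).
Proof.
move=> Fi; elim: N => [|N IH].
  rewrite big_ord0 (eq_circle_mean (g := fun=> 0)).
    by rewrite /circle_mean circle_int_cst !mulr0.
  by move=> t; rewrite big_ord0.
rewrite big_ord_recr/= -IH -circle_meanZ// -circle_meanD//; last 2 first.
- exact: circle_integrable_sum.
- exact: circle_integrableZ.
by apply: eq_circle_mean => t; rewrite big_ord_recr.
Qed.

Lemma circle_mean_exprz n : circle_mean (fun x : R[i] => x ^ n) = (n == 0)%:R.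
Proof.
rewrite /circle_mean circle_int_exprz; case: eqP => _; last by rewrite mulr0.
by rewrite -rmorphM mulVf ?twopi_neq0.
Qed.

(* Integrating a uniformly convergent power series in X term by term. *)
Lemma wiener_mean f (c : nat -> R[i]) (X : R[i] -> R[i]) m : wiener f c ->
  (forall k : nat, circle_measurable (fun x => X x ^+ k)) ->
  circle_measurable (fun x => f (X x)) ->
  (forall t, normc (X (expi t)) = 1) ->
  exists2 e : nat -> R, e @ \oo --> (0 : R) & forall N,
    normc (circle_mean (fun x => f (X x) * x ^ (- m)) -
      \sum_(k < N) c k * circle_mean (fun x => X x ^+ k * x ^ (- m))) <= e N.
Proof.
move=> [_ [e e0 He]] Xm fXm X1; exists (fun N => 2 * e N).
  by rewrite -[X in _ --> X](mulr0 2); apply: cvgM => //; exact: cvg_cst.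
have Fi k : circle_integrable (fun x => X x ^+ k * x ^ (- m)).
  apply: (@circle_integrable_bounded _ _ 1).
    by apply: circle_measurableM => //; exact: circle_measurable_exprz.
  by move=> t; rewrite Normc.normcM normc_expi_exprz normcX X1 expr1n mulr1.
(* The estimate for the empty partial sum, [N = 0], bounds [f] on the circle by [e 0]. *)
have fi : circle_integrable (fun x => f (X x) * x ^ (- m)).
  apply: (@circle_integrable_bounded _ _ (e 0%N)).
    by apply: circle_measurableM => //; exact: circle_measurable_exprz.
  move=> t; rewrite Normc.normcM normc_expi_exprz mulr1.
  by have := He 0%N _ (X1 t); rewrite big_ord0 subr0.
move=> N; have Si := @circle_integrable_sum c _ N Fi.
rewrite -(@circle_mean_sum c _ N Fi) -[X in _ - X]mul1r -mulNr.
rewrite -circle_meanZ// -circle_meanD//; last exact: circle_integrableZ.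
apply: circle_mean_bound.
  apply: circle_integrable_measurable; apply: circle_integrableD => //.
  exact: circle_integrableZ.
move=> t; rewrite mulN1r.
under eq_bigr do rewrite mulrA.
by rewrite -mulr_suml -mulrBl Normc.normcM normc_expi_exprz mulr1; exact: He.
Qed.

Lemma cvg0_eq0 (z : R[i]) (e : nat -> R) (N0 : nat) : e @ \oo --> (0 : R) ->
  (forall N, (N0 <= N)%N -> normc z <= e N) -> z = 0.
Proof.
move=> e0 ze; apply: Normc.eq0_normc; apply/eqP; rewrite eq_le normc_ge0 andbT.
rewrite leNgt; apply/negP => zp.
have /cvgrPdist_lt /(_ _ zp) [N1 _ H] := e0.
have := H (maxn N0 N1) (leq_maxr _ _); rewrite /= sub0r normrN.
rewrite ltNge => /negP; apply; apply: le_trans (ler_norm _).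
exact/ze/leq_maxl.
Qed.

Lemma expi_exprzN (t : R) n : (expi t ^ n)^* = expi t ^ (- n).
Proof. by rewrite !expi_exprz -expiN mulrNz mulNr. Qed.

Lemma sqr_fourier_cst :
  ((Num.sqrt (2 * pi : R))^-1)%:C * ((Num.sqrt (2 * pi : R))^-1)%:C^* =
  ((2 * pi)^-1)%:C :> R[i].
Proof.
rewrite conjC_real_complex -rmorphM -invfM -expr2 sqr_sqrtr//.
by rewrite mulr_ge0// pi_ge0.
Qed.

Lemma inner_fourierE f g (s : R[i]) (h : R[i] -> R[i]) : circle_integrable h ->
  (forall t, f (expi t) * (g (expi t))^* = s * h (expi t)) ->
  inner f g = s * circle_int h.
Proof.
by move=> hi fgh; rewrite -circle_intZ//; apply: eq_circle_int => t _; rewrite fgh.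
Qed.

Lemma circle_measurable_fourier (n : int) : circle_measurable (@fourier R n).
Proof.
apply: circle_measurableM; first exact: circle_measurable_cst.
exact: circle_measurable_exprz.
Qed.

Lemma normc_fourier (n : int) t :
  normc (fourier n (expi t)) = normc ((Num.sqrt (2 * pi))^-1)%:C.
Proof. by rewrite Normc.normcM normc_expi_exprz mulr1. Qed.

(** [Pproj f] differs from [f] by a constant, which is orthogonal to every nonconstant
    exponential. *)
Lemma inner_Pproj_fourier (f : R[i] -> R[i]) (K : R) (n : int) :
  circle_measurable f -> (forall t, normc (f (expi t)) <= K) -> n != 0 ->
  inner (Pproj f) (fourier n) = inner f (fourier n).
Proof.
move=> fm fK n0; rewrite /inner.
pose s : R[i] := ((Num.sqrt (2 * pi))^-1)%:C.
transitivity (circle_int (fun x : R[i] => f x * (fourier n x)^* +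
    - (circle_mean f * s) * x ^ (- n))).
  apply: eq_circle_int => t _; rewrite /Pproj -/(circle_mean f) mulrBl mulNr.
  by rewrite /fourier rmorphM /= expi_exprzN conjC_real_complex -/s !mulrA.
rewrite circle_intD.
- rewrite circle_intZ; last exact: circle_integrable_exprz.
  by rewrite circle_int_exprz oppr_eq0 (negbTE n0) mulr0 addr0.
- apply: (@circle_integrable_bounded _ _ (K * normc s)).
    apply: circle_measurableM => //; apply: circle_measurable_conj.
    exact: circle_measurable_fourier.
  by move=> t; rewrite Normc.normcM normc_conj normc_fourier ler_wpM2r ?normc_ge0.
- by apply: circle_integrableZ; exact: circle_integrable_exprz.
Qed.

End CircleMean.

(** * Boundedness of the two operators *)

Section MoebiusOperators.
Variables (R : realType) (rho zeta : R).
Hypotheses (rho_ge0 : 0 <= rho) (rho_lt1 : rho < 1).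
Local Notation mu := (@lebesgue_measure R).
Local Notation circ := (@period R).
Local Notation Re := (@complex.Re R).
Local Notation Im := (@complex.Im R).
Local Notation normc := (@Normc.normc R).
Local Notation jac := (moebius_jac rho zeta).
Local Notation arg := (moebius_arg rho zeta).
Local Notation a := (rho%:C * expi zeta).
Implicit Types (f g : R[i] -> R[i]).
Let mcirc : measurable circ := @measurable_period R.

Lemma normc_moebius_param : normc a = rho.
Proof. by rewrite Normc.normcM normc_expi mulr1 normc_real_complex. Qed.

Lemma Mop_expi f t : Mop a f (expi t) = f (expi (arg t)).
Proof. by rewrite expi_moebius_arg. Qed.

Lemma Jhalf_expi f t : Jhalf a f (expi t) = (jac t)%:C * f (expi t).
Proof.
rewrite /Jhalf; congr (_ * _).
have nE (z : R[i]) : `|z| ^+ 2 = (normc z ^+ 2)%:C by rewrite rmorphXn.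
rewrite !nE normc_moebius_param.
have -> : normc (a^* * expi t - 1) ^+ 2 =
    1 - 2 * rho * cos (t - zeta) + rho ^+ 2.
  have -> : a^* * expi t = rho%:C * expi (t - zeta).
    rewrite rmorphM /= conjC_real_complex -mulrA; congr (_ * _).
    by rewrite addrC expiD expiN.
  rewrite sqr_normc_ReIm Re_add Im_add Re_mul Im_mul Re_opp Im_opp/=.
  rewrite !mul0r !subr0 !addr0 exprMn sin2cos2; ring.
by rewrite -rmorphB -fmorphV -rmorphM.
Qed.

Lemma circle_measurable_Mop f : circle_measurable f ->
  circle_measurable (Mop a f).
Proof.
move=> [f1 f2]; split.
  rewrite (_ : (fun t => _) = (fun t => Re (f (expi t))) \o arg).
    exact: measurable_comp_moebius_arg.
  by apply/funext => t; rewrite Mop_expi.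
rewrite (_ : (fun t => _) = (fun t => Im (f (expi t))) \o arg).
  exact: measurable_comp_moebius_arg.
by apply/funext => t; rewrite Mop_expi.
Qed.

Lemma circle_measurable_Jhalf f : circle_measurable f ->
  circle_measurable (Jhalf a f).
Proof.
move=> [f1 f2]; split.
  rewrite (_ : (fun t => _) = (fun t => jac t * Re (f (expi t)))).
    by apply: measurable_funM => //; exact: moebius_jac_measurable.
  by apply/funext => t; rewrite Jhalf_expi Re_real_mul.
rewrite (_ : (fun t => _) = (fun t => jac t * Im (f (expi t)))).
  by apply: measurable_funM => //; exact: moebius_jac_measurable.
by apply/funext => t; rewrite Jhalf_expi Im_real_mul.
Qed.

(** The change of variables in operator form. It shows that [J_a^{1/2} M_a] preserves mean zero, and
    it moves [M_a] across the inner product in the computation of matrix entries. *)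
Lemma circle_int_Jhalf_Mop f : circle_measurable f ->
  circle_int (Jhalf a (Mop a f)) = circle_int f.
Proof.
move=> [f1 f2]; rewrite /circle_int; congr (_ +i* _).
  rewrite -[RHS](@Rintegral_moebius_arg _ rho zeta)//.
  apply: eq_Rintegral => t _.
  by rewrite Jhalf_expi Mop_expi Re_real_mul.
rewrite -[RHS](@Rintegral_moebius_arg _ rho zeta)//.
apply: eq_Rintegral => t _.
by rewrite Jhalf_expi Mop_expi Im_real_mul.
Qed.

Let C : R := (1 - rho ^+ 2) / (1 - rho) ^+ 2.
Let k : R := (1 - rho ^+ 2) / (1 + rho) ^+ 2.

Let k_gt0 : 0 < k.
Proof. by apply: divr_gt0; rewrite ?subr_gt0 ?expr_lt1// exprn_gt0// ltr_pwDl. Qed.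

Let C_ge0 : 0 <= C.
Proof. by rewrite divr_ge0 ?sqr_ge0// subr_ge0 exprn_ile1// ltW. Qed.

Let jac_ge0 t : 0 <= jac t.
Proof. exact/ltW/moebius_jac_gt0. Qed.

(** The factor [jac t / k >= 1] is inserted so that the bound becomes an exact change of variables.
    For [J_a^{1/2} M_a] the density occurs squared, and one factor is bounded by [C]. *)
Lemma sqr_modulus_Mop_le f t : sqr_modulus (Mop a f) t <=
  k^-1 * (jac t * sqr_modulus f (arg t)).
Proof.
rewrite ler_pdivlMl// /sqr_modulus Mop_expi ler_wpM2r ?sqr_ge0//.
exact: moebius_jac_ge.
Qed.

Lemma sqr_modulus_Jhalf_Mop_le f t : sqr_modulus (Jhalf a (Mop a f)) t <=
  C * (jac t * sqr_modulus f (arg t)).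
Proof.
rewrite /sqr_modulus Jhalf_expi Mop_expi Normc.normcM exprMn normc_real_complex//.
rewrite mulrA ler_wpM2r ?sqr_ge0// expr2 ler_wpM2r//.
exact: moebius_jac_le.
Qed.

Lemma L2_bound f g (K : R) : L2 f -> 0 <= K -> circle_measurable g ->
  (forall t, sqr_modulus g t <= K * (jac t * sqr_modulus f (arg t))) ->
  L2 g /\ L2norm g <= Num.sqrt K * L2norm f.
Proof.
move=> /L2P[fm fi] K0 gm gf.
have i1 := integrableZlR K (integrable_moebius_arg zeta rho_ge0 rho_lt1 fi).
have gi : mu.-integrable circ (EFin \o sqr_modulus g).
  apply: (integrable_dominatedR _ _ i1); first exact: measurable_sqr_modulus.
  move=> t; rewrite ger0_norm ?sqr_modulus_ge0//.
  exact: le_trans (gf t) (ler_norm _).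
split; first exact/L2P.
rewrite !L2normE -sqrtrM// ler_wsqrtr//.
rewrite -(@Rintegral_moebius_arg _ rho zeta rho_ge0 rho_lt1 (sqr_modulus f)); last first.
  exact: measurable_sqr_modulus.
rewrite -RintegralZl//; last exact: integrable_moebius_arg.
apply: le_Rintegral => [//|//|//|t _]; last exact: gf.
Qed.

Lemma L2_Mop f : L2 f ->
  L2 (Mop a f) /\ L2norm (Mop a f) <= Num.sqrt k^-1 * L2norm f.
Proof.
move=> fL; have [fm _] := (L2P f).1 fL; apply: L2_bound => //.
- by rewrite invr_ge0 ltW.
- exact: circle_measurable_Mop.
- exact: sqr_modulus_Mop_le.
Qed.

Lemma L2_Jhalf_Mop f : L2 f ->
  L2 (Jhalf a (Mop a f)) /\ L2norm (Jhalf a (Mop a f)) <= Num.sqrt C * L2norm f.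
Proof.
move=> fL; have [fm _] := (L2P f).1 fL; apply: L2_bound => //.
- exact/circle_measurable_Jhalf/circle_measurable_Mop.
- exact: sqr_modulus_Jhalf_Mop_le.
Qed.

Lemma circle_ae_eq_Mop f g : circle_ae_eq f g -> circle_ae_eq (Mop a f) (Mop a g).
Proof.
move=> /(ae_moebius_arg zeta rho_ge0 rho_lt1 (P := fun t => f (expi t) = g (expi t))) H.
by apply: (ae_imply H) => t Ht tp; rewrite !Mop_expi; exact: Ht.
Qed.

Lemma circle_ae_eq_refl f g : (forall t, f (expi t) = g (expi t)) -> circle_ae_eq f g.
Proof. by move=> fg; apply: aeW => t _. Qed.

Lemma bounded_Jhalf_Mop : bounded_operator (fun f => Jhalf a (Mop a f)).
Proof.
split.
- move=> f [fL f0]; split; first exact: (L2_Jhalf_Mop fL).1.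
  by rewrite circle_int_Jhalf_Mop//; have [] := (L2P f).1 fL.
- move=> f g _ _ /circle_ae_eq_Mop H.
  by apply: (ae_imply H) => t Ht tp; rewrite !Jhalf_expi Ht.
- move=> c f g _ _; apply: circle_ae_eq_refl => t.
  by rewrite !Jhalf_expi !Mop_expi; ring.
- by exists (Num.sqrt C) => f [fL _]; exact: (L2_Jhalf_Mop fL).2.
Qed.

Lemma bounded_Pproj_Mop : bounded_operator (fun f => Pproj (Mop a f)).
Proof.
split.
- move=> f [fL f0]; have [ML _] := L2_Mop fL; split; first exact: L2_Pproj.
  exact/circle_int_Pproj/L2_circle_integrable.
- move=> f g [fL _] [gL _] /circle_ae_eq_Mop H.
  have [[fm _] [gm _]] := ((L2P _).1 (L2_Mop fL).1, (L2P _).1 (L2_Mop gL).1).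
  by apply: (ae_imply H) => t Ht tp; rewrite /Pproj (ae_eq_circle_int fm gm H) Ht.
- move=> c f g [fL _] [gL _].
  have fi := L2_circle_integrable (L2_Mop fL).1.
  have gi := L2_circle_integrable (L2_Mop gL).1.
  apply: circle_ae_eq_refl => t; rewrite /Pproj.
  have -> : circle_int (Mop a (fun x => c * f x + g x)) =
      c * circle_int (Mop a f) + circle_int (Mop a g).
    by rewrite -circle_intZ// -circle_intD//; exact: circle_integrableZ.
  by rewrite /Mop/=; ring.
- exists (Num.sqrt k^-1) => f [fL _]; have [ML MN] := L2_Mop fL.
  exact: le_trans (L2norm_Pproj ML) MN.
Qed.

End MoebiusOperators.

(** * The matrix *)

Section MoebiusAlgebra.
Variable R : realType.
Local Notation normc := (@Normc.normc R).

Lemma moebius_den_neq0 (b x : R[i]) : normc b < 1 -> normc x = 1 ->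
  b^* * x - 1 != 0.
Proof.
move=> b1 x1; rewrite subr_eq0; apply: contra_ltN b1 => /eqP E.
by have := congr1 normc E; rewrite Normc.normcM normc_conj x1 mulr1 Normc.normc1 => ->.
Qed.

Lemma moebius_involutive (b x : R[i]) : normc b < 1 -> normc x = 1 ->
  moebius b (moebius b x) = x.
Proof.
move=> b1 x1; have d0 := moebius_den_neq0 b1 x1.
have bb : 1 - b * b^* != 0.
  rewrite subr_eq0 eq_sym; apply: contra_ltN b1 => /eqP E.
  have := congr1 normc E; rewrite Normc.normc1 Normc.normcM normc_conj => E1.
  by rewrite -(@ler_pXn2r _ 2)// ?nnegrE ?normc_ge0// expr1n expr2 E1.
have E1 : (x - b) / (b^* * x - 1) - b = x * (1 - b * b^*) / (b^* * x - 1).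
  by field.
have E2 : b^* * ((x - b) / (b^* * x - 1)) - 1 = (1 - b * b^*) / (b^* * x - 1).
  by field.
rewrite /moebius E1 E2; field.
by rewrite d0 bb.
Qed.

End MoebiusAlgebra.

Section MoebiusEntries.
Variables (R : realType) (rho zeta : R).
Hypotheses (rho_ge0 : 0 <= rho) (rho_lt1 : rho < 1).
Local Notation normc := (@Normc.normc R).
Local Notation a := (rho%:C * expi zeta : R[i]).
Local Notation arg := (moebius_arg rho zeta).
Implicit Types (f g : R[i] -> R[i]) (n m : int).

Lemma normc_a_lt1 : normc a < 1.
Proof. by rewrite normc_moebius_param. Qed.

Lemma circle_measurable_moebiusX n : circle_measurable (fun x => moebius a x ^ n).
Proof.
exact: (circle_measurable_Mop zeta rho_ge0 rho_lt1 (circle_measurable_exprz R n)).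
Qed.

Lemma normc_moebiusX n t : normc (moebius a (expi t) ^ n) = 1.
Proof. by rewrite -expi_moebius_arg// normc_expi_exprz. Qed.

Lemma circle_integrable_entry n m :
  circle_integrable (fun x => moebius a x ^ n * x ^ m).
Proof.
apply: (@circle_integrable_bounded _ _ 1).
  apply: circle_measurableM; first exact: circle_measurable_moebiusX.
  exact: circle_measurable_exprz.
by move=> t; rewrite Normc.normcM normc_moebiusX normc_expi_exprz mulr1.
Qed.

(** The [m]-th Fourier coefficient of [M_a^n]. *)
Definition moebius_mean n m : R[i] :=
  circle_mean (fun x => moebius a x ^ n * x ^ (- m)).

Lemma inner_fourier_Mop n m : inner (fourier m) (Mop a (fourier n)) =
  moebius_mean (- n) (- m).
Proof.
apply: inner_fourierE; first exact: circle_integrable_entry.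
move=> t; rewrite /Mop/= /fourier -expi_moebius_arg// rmorphM /= expi_exprzN opprK.
by rewrite mulrACA sqr_fourier_cst [expi t ^ m * _]mulrC.
Qed.

Lemma inner_Mop_fourier n m : inner (Mop a (fourier m)) (fourier n) =
  moebius_mean m n.
Proof.
apply: inner_fourierE; first exact: circle_integrable_entry.
move=> t; rewrite /Mop/= /fourier rmorphM /= expi_exprzN.
by rewrite mulrACA sqr_fourier_cst.
Qed.

Lemma moebius_mean_conj n m : (moebius_mean n m)^* = moebius_mean (- n) (- m).
Proof.
rewrite /moebius_mean /circle_mean rmorphM /= conjC_real_complex.
rewrite -circle_int_conj; last exact: circle_integrable_entry.
congr (_ * _); apply: eq_circle_int => t _.
by rewrite rmorphM /= -!expi_moebius_arg// !expi_exprzN.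
Qed.

Lemma Hmx_mean n m : Hmx a n m = (moebius_mean n m)^*.
Proof. by rewrite moebius_mean_conj -inner_fourier_Mop. Qed.

Lemma Hmx_centrohermitian n m : Hmx a n m = (Hmx a (- n) (- m))^*.
Proof. by rewrite !Hmx_mean moebius_mean_conj conjCK. Qed.

(** Term-by-term integration with [X = id] picks out the coefficient of [x^m]. The absence of
    negative powers is the source of the block structure. *)
Lemma moebius_mean_coef (n : nat) m : (0 < n)%N ->
  moebius_mean n m = if m is Posz p then moebius_coef a n p else 0.
Proof.
move=> n0; have W := wiener_moebius normc_a_lt1 n0.
have [|||e e0 He] := wiener_mean (X := id) m W.
- by move=> k; exact: (circle_measurable_exprz R k).
- exact: (circle_measurable_moebiusX n).
- by move=> t; exact: normc_expi.
(* The partial sum over [k < N] contains the index [p] only from [N = p.+1] on. *)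
apply: subr0_eq; pose N0 := (if m is Posz p then p.+1 else 0)%N.
apply: (cvg0_eq0 (N0 := N0) e0) => N NN.
apply: le_trans (He N); rewrite le_eqVlt; apply/orP; left; apply/eqP.
congr (normc (_ - _)).
have E (k : nat) : circle_mean (fun x : R[i] => x ^+ k * x ^ (- m)) = (k%:Z == m)%:R.
  rewrite (eq_circle_mean (g := fun x => x ^ (k%:Z - m))).
    by rewrite circle_mean_exprz subr_eq0.
  by move=> t; rewrite expfzDr ?expi_neq0.
under eq_bigr do rewrite E.
case: m @N0 NN {He E} => [p|p] N0 NN.
  rewrite (bigD1 (Ordinal (NN : (p < N)%N)))//= eqxx mulr1 big1 ?addr0// => k /eqP kp.
  case: eqP => [[pk]|_]; last by rewrite mulr0.
  by exfalso; apply: kp; apply: val_inj.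
by rewrite big1// => k _; rewrite mulr0.
Qed.

(** The power series of [M_a^n] has a constant term while the matrices have no index 0; this removes
    that term from the product. *)
Lemma moebius_mean0 m : m != 0 -> moebius_mean 0 m = 0.
Proof.
move=> m0; rewrite /moebius_mean (eq_circle_mean (g := fun x => x ^ (- m))).
  by rewrite circle_mean_exprz oppr_eq0 (negbTE m0).
by move=> t; rewrite expr0z mul1r.
Qed.

Lemma moebius_mean_bound n m : normc (moebius_mean n m) <= 2.
Proof.
rewrite -[leRHS]mulr1; apply: circle_mean_bound.
  by have /circle_integrable_measurable := circle_integrable_entry n (- m).
by move=> t; rewrite Normc.normcM normc_moebiusX normc_expi_exprz mulr1.
Qed.

(* Substituting M_a into the power series of M_a^n and integrating against
   e^{-imt}, since M_a (M_a x) = x. *)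
Lemma moebius_mean_involution (n : nat) m : (0 < n)%N ->
  exists2 e : nat -> R, e @ \oo --> (0 : R) & forall N,
    normc ((n%:Z == m)%:R -
      \sum_(k < N) moebius_coef a n k * moebius_mean k m) <= e N.
Proof.
move=> n0; have W := wiener_moebius normc_a_lt1 n0.
have EM t : moebius a (moebius a (expi t)) = expi t.
  by rewrite moebius_involutive ?normc_a_lt1 ?normc_expi.
have [|||e e0 He] := wiener_mean (X := moebius a) m W.
- by move=> k; exact: (circle_measurable_moebiusX k).
(* Composing [M_a^n] with [M_a] gives [x^n] on the circle, so measurability is that of a
   monomial. *)
- have [h1 h2] := circle_measurable_exprz R n.
  split; [move: h1|move: h2]; apply: eq_measurable_fun => t _; by rewrite EM.
- by move=> t; have := normc_moebiusX 1 t; rewrite expr1z.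
exists e => // N; apply: le_trans (He N).
rewrite le_eqVlt; apply/orP; left; apply/eqP; congr (normc (_ - _)).
rewrite (eq_circle_mean (g := fun x => x ^ (n%:Z - m))).
  by rewrite circle_mean_exprz subr_eq0.
by move=> t; rewrite EM expfzDr ?expi_neq0.
Qed.

End MoebiusEntries.

(** * Dependence of the coefficients on the argument of [a] *)

Section MoebiusCoefficients.
Variables (R : realType) (rho zeta : R).
Local Notation a := (rho%:C * expi zeta : R[i]).

Lemma conj_real_mul (x : R) (z : R[i]) : (x%:C * z)^* = x%:C * z^*.
Proof. by rewrite rmorphM /= conjC_real_complex. Qed.

Lemma conj_polarX (j : nat) (t : R) :
  ((rho%:C * expi t) ^+ j)^* = (rho%:C * expi (- t)) ^+ j.
Proof. by rewrite rmorphXn /= conj_real_mul expiN. Qed.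

Lemma conj_moebius_term (x : R) (k j : nat) :
  (x%:C * (a ^+ k * a^* ^+ j))^* =
  expi ((j%:Z - k%:Z)%:~R * zeta) * (x%:C * (rho%:C ^+ k * rho%:C^* ^+ j)).
Proof.
rewrite [LHS]conj_real_mul mulrCA; congr (_ * _).
rewrite conj_real_mul -expiN conjC_real_complex.
rewrite [LHS]rmorphM /= !conj_polarX opprK.
rewrite !exprMn mulrACA [RHS]mulrC; congr (_ * _).
rewrite !expi_exprn -expiD; congr expi.
by rewrite rmorphB /=; ring.
Qed.

Lemma moebius_coef_signE (p q r : nat) :
  (-1) ^+ p * q%:R * r%:R = ((-1) ^+ p * q%:R * r%:R : R)%:C.
Proof. by rewrite !rmorphM !rmorph_nat rmorphXn rmorphN1. Qed.

(** The conjugated [k]-th term has phase [e^{i(j - k) zeta}] with [j = k + m - n], which is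
    [e^{i(m - n) zeta}] for every [k] and so factors out. The guard [n - k <= m] makes the truncated
    [j] exact. *)
Lemma moebius_coef_rotate (n m : nat) : (moebius_coef a n m)^* =
  expi ((m%:Z - n%:Z)%:~R * zeta) * moebius_coef rho%:C n m.
Proof.
rewrite /moebius_coef [RHS]mulr_sumr [LHS]rmorph_sum; apply: eq_bigr => k _.
have [nkm|_] := boolP (n - k <= m)%N; last by rewrite mulr0; exact: rmorph0.
have kn : (k <= n)%N by rewrite -ltnS.
rewrite moebius_coef_signE; apply: etrans (conj_moebius_term _ _ _) _.
by congr (expi (_%:~R * _) * _); lia.
Qed.

End MoebiusCoefficients.

Section NonzeroSums.
Variable R : realType.
Local Notation normc := (@Normc.normc R).
Implicit Types (u : int -> R[i]).

Lemma summable_nneg u (K : R) : (forall k : int, k < 0 -> u k = 0) ->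
  (forall N, \sum_(k < N) normc (u k%:Z) <= K) ->
  summable [set k : int | k != 0] (fun k => (normc (u k))%:E).
Proof.
move=> u0 uK; rewrite /summable.
rewrite (esumID [set k : int | 0 < k]); last by move=> k _; exact: abse_ge0.
rewrite [X in (_ + X)%E]esum1 ?adde0; last first.
  move=> k [/= k0 /negP]; rewrite -leNgt => k1.
  by rewrite u0 ?Normc.normc0 ?normr0// lt_neqAle k0.
have -> : [set k : int | k != 0] `&` [set k | 0 < k] = [set k | 0 < k].
  by apply/seteqP; split=> [k []//|k /= k0]; split=> //=; rewrite gt_eqF.
rewrite (reindex_esum [set n : nat | (0 < n)%N] _ Posz); last first.
  split.
  - by move=> n.
  - by move=> m n _ _ [].
  - by case=> // n n0; exists n.
rewrite -(nneseries_esum (P := fun n => (0 < n)%N)); last first.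
  by move=> n _; exact: abse_ge0.
apply: (@le_lt_trans _ _ K%:E); last exact: ltry.
apply: lime_le; first by apply: is_cvg_nneseries_cond => n _ _; exact: abse_ge0.
apply: nearW => N; rewrite big_mkcond/= big_mkord.
apply: (@le_trans _ _ (\sum_(k < N) (normc (u k%:Z))%:E)%E).
  apply: lee_sum => k _; case: ifP => _; last by rewrite lee_fin normc_ge0.
  by rewrite lee_fin ger0_norm ?normc_ge0.
by rewrite sumEFin lee_fin.
Qed.

(** Negation permutes the nonzero integers and fixes each symmetric partial sum. This transfers the
    product from positive to negative rows. *)
Lemma nzsum_conjN u l : nzsum u l -> nzsum (fun k => (u (- k))^*) l^*.
Proof.
move=> [us ul]; split.
  rewrite /summable; move: us; rewrite /summable.
  rewrite (reindex_esum [set k : int | k != 0] _ (fun k => - k)).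
    by under eq_esum do rewrite -normc_conj.
  split.
  - by move=> k /=; rewrite oppr_eq0.
  - by move=> k k' _ _ /oppr_inj.
  - by move=> k /= k0; exists (- k) => /=; rewrite ?oppr_eq0// opprK.
rewrite (_ : (fun N => _) = fun N : nat => Normc.normc
     (\sum_(1 <= k < N.+1) (u k%:Z + u (- k%:Z)) - l))//.
apply/funext => N; rewrite -[RHS]normc_conj rmorphB rmorph_sum/=.
congr (normc (_ - _)); apply: eq_bigr => k _.
by rewrite opprK -rmorphD addrC.
Qed.

End NonzeroSums.

Section MoebiusMatrix.
Variables (R : realType) (rho zeta : R).
Hypotheses (rho_ge0 : 0 <= rho) (rho_lt1 : rho < 1).
Local Notation normc := (@Normc.normc R).
Local Notation a := (rho%:C * expi zeta : R[i]).

Lemma moebius_mean_neg (n p : nat) : (0 < n)%N -> moebius_mean rho zeta n (Negz p) = 0.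
Proof. by move=> n0; rewrite moebius_mean_coef. Qed.

(** Row [n] vanishes at negative columns and is absolutely summable by [wiener_moebius], while the
    other factor is bounded by 2. The limit is the conjugate of [moebius_mean_involution]. *)
Lemma nzsum_Hmx_nat (n : nat) (m : int) : (0 < n)%N -> m != 0 ->
  nzsum (fun k => Hmx a n k * Hmx a k m) (@matrix_id R n m).
Proof.
move=> n0 m0.
have [[K HK] _] := wiener_moebius (normc_a_lt1 zeta rho_ge0 rho_lt1) n0.
have Hn p : Hmx a n (Negz p) = 0 by rewrite Hmx_mean// moebius_mean_neg// rmorph0.
have Hp (k : nat) : Hmx a n k = (moebius_coef a n k)^*.
  by rewrite Hmx_mean// moebius_mean_coef.
split.
  apply: (@summable_nneg _ _ (K * 2)).
    by case=> // p _; rewrite Hn mul0r.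
  move=> N; apply: le_trans (ler_wpM2r _ (HK N)) => //.
  rewrite mulr_suml; apply: ler_sum => k _.
  rewrite Normc.normcM Hp normc_conj ler_wpM2l ?normc_ge0//.
  by rewrite Hmx_mean// normc_conj moebius_mean_bound.
have [e e0 He] := moebius_mean_involution zeta rho_ge0 rho_lt1 m n0.
apply: (@squeeze_cvgr _ _ _ _ (fun=> 0) (fun N => e N.+1)); last 2 first.
- exact: cvg_cst.
- by rewrite (cvg_shiftS e).
apply: nearW => N; rewrite normc_ge0/=.
apply: le_trans (He N.+1); rewrite le_eqVlt; apply/orP; left; apply/eqP.
rewrite -[RHS]normc_conj -normcN opprB rmorphB.
congr (normc (_ - _)); first by rewrite /matrix_id rmorph_nat.
(* The power series starts at [k = 0] and the matrix product at [k = 1], whence the error at [N.+1];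
   the extra term vanishes because [m] is nonzero. *)
rewrite rmorph_sum big_ord_recl moebius_mean0// mulr0 rmorph0 add0r.
rewrite big_add1/= big_mkord; apply: eq_bigr => k _.
rewrite rmorphM /= Hp (_ : - k.+1%:Z = Negz k)//.
by rewrite Hn mul0r addr0 Hmx_mean.
Qed.

Lemma Hmx_involutory : involutory (Hmx a).
Proof.
suff H : matrix_prod (Hmx a) (Hmx a) (@matrix_id R) by split.
move=> [n|n] m n0 m0; first by apply: nzsum_Hmx_nat => //; rewrite lt0n.
(* A negative row: centrohermitian symmetry turns it into row [n.+1] against column [- m]. *)
have m0' : - m != 0 by rewrite oppr_eq0.
have := nzsum_conjN (nzsum_Hmx_nat (ltn0Sn n) m0').
rewrite (_ : (fun k => _) = (fun k => Hmx a (Negz n) k * Hmx a k m)).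
  congr nzsum; rewrite /matrix_id rmorph_nat NegzE; congr (nat_of_bool _)%:R.
  by rewrite eqr_oppLR.
apply/funext => k; rewrite rmorphM /=.
rewrite NegzE [Hmx a (- _) k]Hmx_centrohermitian// [Hmx a k m]Hmx_centrohermitian//.
Qed.

Lemma Hmx_off_diagonal (n m : int) :
  (n < 0 /\ 0 < m) \/ (0 < n /\ m < 0) -> Hmx a n m = 0.
Proof.
have H (p q : nat) : Hmx a p.+1 (Negz q) = 0.
  by rewrite Hmx_mean// moebius_mean_neg// rmorph0.
case=> [[]|[]]; last by case: n => // -[//|n] _; case: m.
case: n => // n _; case: m => // -[//|m] _.
by rewrite Hmx_centrohermitian// !NegzE opprK H rmorph0.
Qed.

Lemma Hmx_nat (n m : nat) : (0 < n)%N -> Hmx a n m = (moebius_coef a n m)^*.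
Proof. by move=> n0; rewrite Hmx_mean// moebius_mean_coef. Qed.

(** The change of variables is applied to the integrand of [Hmx a n m]: [M_a] lands on [fourier m]
    and cancels on [fourier n], being an involution of the circle. *)
Lemma matrix_rep_Jhalf_Mop : matrix_rep (fun f => Jhalf a (Mop a f)) (Hmx a).
Proof.
split; first exact: bounded_Jhalf_Mop.
move=> n m _ _; rewrite /Hmx /inner.
pose h (x : R[i]) := fourier m x * (Mop a (fourier n) x)^*.
have hm : circle_measurable h.
  apply: circle_measurableM; first exact: circle_measurable_fourier.
  apply: circle_measurable_conj; apply: circle_measurable_Mop => //.
  exact: circle_measurable_fourier.
rewrite -(circle_int_Jhalf_Mop zeta rho_ge0 rho_lt1 hm).
apply: eq_circle_int => t _; rewrite /Jhalf /Mop /h /Mop/= mulrA.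
by rewrite moebius_involutive ?normc_a_lt1 ?normc_expi.
Qed.

Lemma matrix_rep_Pproj_Mop :
  matrix_rep (fun f => Pproj (Mop a f)) (conj_transpose (Hmx a)).
Proof.
split; first exact: bounded_Pproj_Mop.
move=> n m n0 m0.
rewrite (@inner_Pproj_fourier R _ (normc ((Num.sqrt (2 * pi))^-1)%:C))//.
- rewrite inner_Mop_fourier//.
  transitivity ((Hmx a m n)^*) => //.
  by rewrite Hmx_mean// conjCK.
- by apply: circle_measurable_Mop => //; exact: circle_measurable_fourier.
- by move=> t; rewrite Mop_expi// normc_fourier.
Qed.

End MoebiusMatrix.

Section MoebiusMatrixFormulas.
Variables (R : realType) (rho : R).
Hypotheses (rho_ge0 : 0 <= rho) (rho_lt1 : rho < 1).

(** Makes the real parameter the case [zeta = 0] of the polar form. *)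
Let rhoE : rho%:C = rho%:C * expi 0 :> R[i].
Proof. by rewrite expi0 mulr1. Qed.

Lemma Hmx_real_nat (n m : nat) : (0 < n)%N ->
  Hmx rho%:C n m = moebius_coef rho%:C n m.
Proof.
move=> n0; rewrite [in LHS]rhoE Hmx_nat// moebius_coef_rotate.
by rewrite mulr0 expi0 mul1r.
Qed.

Lemma Hmx_rotate_nat (zeta : R) (n : nat) (m : int) : (0 < n)%N -> m != 0 ->
  Hmx (rho%:C * expi zeta) n m =
  expi ((m - n%:Z)%:~R * zeta) * Hmx rho%:C n m.
Proof.
move=> n0; case: m => [m|m] m0.
  by rewrite Hmx_nat// moebius_coef_rotate Hmx_real_nat.
have nm : ((n%:Z < 0) /\ 0 < Negz m) \/ (0 < n%:Z) /\ (Negz m < 0) by right.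
by rewrite [in RHS]rhoE !Hmx_off_diagonal// mulr0.
Qed.

Lemma Hmx_rotate (zeta : R) (n m : int) : n != 0 -> m != 0 ->
  Hmx (rho%:C * expi zeta) n m = expi ((m - n)%:~R * zeta) * Hmx rho%:C n m.
Proof.
case: n => [n|n] n0 m0; first by apply: Hmx_rotate_nat => //; rewrite lt0n.
rewrite [LHS]Hmx_centrohermitian// [X in Hmx X (Negz n)]rhoE.
rewrite [Hmx _ (Negz n) _]Hmx_centrohermitian// -rhoE.
rewrite NegzE opprK Hmx_rotate_nat ?oppr_eq0//.
rewrite rmorphM /= -expiN; congr (expi _ * _).
by rewrite -mulNr -mulrNz; congr (_%:~R * _); ring.
Qed.

Lemma Hmx_real_formula (n m : nat) : (0 < n)%N -> (0 < m)%N ->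
  Hmx rho%:C n%:Z m%:Z =
  \sum_(maxn (n - m) 0 <= k < n.+1)
    (-1) ^+ (n - k) * 'C(k + m - 1, k + m - n)%:R * 'C(n, k)%:R
      * rho%:C ^+ (2 * k + m - n).
Proof.
move=> n0 m0; rewrite Hmx_real_nat// maxn0 big_geq_mkord /moebius_coef big_mkcond.
rewrite [RHS]big_mkcond/=; apply: eq_bigr => k _.
have kn : (k <= n)%N by rewrite -ltnS.
rewrite leq_subCl; case: ifP => // nmk.
rewrite conjC_real_complex -exprD.
have -> : (k + (k + m - n) = 2 * k + m - n)%N by lia.
(* Symmetry of the binomial: [n - 1] and [k + m - n] add up to [k + m - 1]. *)
rewrite -[in LHS]bin_sub; last by lia.
by have -> : (k + m - 1 - (n - 1) = k + m - n)%N by lia.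
Qed.

End MoebiusMatrixFormulas.

Local Open Scope complex_scope.

Theorem theorem3p1 (R : realType) (rho zeta : R) (rho_ge0 : 0 <= rho)
    (rho_lt1 : rho < 1) :
  let a : R[i] := rho%:C * expi zeta in
  matrix_rep (fun f => Jhalf a (Mop a f)) (Hmx a)
  /\ matrix_rep (fun f => Pproj (Mop a f)) (conj_transpose (Hmx a))
  /\ involutory (Hmx a)
  /\ (forall n m : int, n != 0 -> m != 0 ->
        Hmx a n m = expi ((m - n)%:~R * zeta) * Hmx rho%:C n m)
  /\ (forall n m : int, n != 0 -> m != 0 ->
        Hmx a n m = (Hmx a (- n) (- m))^*)
  /\ (forall n m : int, (n < 0 /\ 0 < m) \/ (0 < n /\ m < 0) -> Hmx a n m = 0)
  /\ (forall n m : nat, (0 < n)%N -> (0 < m)%N ->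
        Hmx rho%:C n%:Z m%:Z =
        \sum_(maxn (n - m) 0 <= k < n.+1)
          (-1) ^+ (n - k) * 'C(k + m - 1, k + m - n)%:R * 'C(n, k)%:R
            * rho%:C ^+ (2 * k + m - n)).
Proof.
move=> a; split; first exact: matrix_rep_Jhalf_Mop.
split; first exact: matrix_rep_Pproj_Mop.
split; first exact: Hmx_involutory.
split; first by move=> n m; exact: Hmx_rotate.
split; first by move=> n m _ _; exact: Hmx_centrohermitian.
split; first by move=> n m; exact: Hmx_off_diagonal.
by move=> n m; exact: Hmx_real_formula.
Qed.
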